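(* Let $V_{\mathbb{R}}$ be a finite dimensional real vector space, $V_{\mathbb{C}} := V_{\mathbb{R}}\otimes_{\mathbb{R}}\mathbb{C}$, and let $A\in \mathrm{End}_{\mathbb{C}}(V_{\mathbb{C}})$ be a weakly pseudo-real $\sigma$-operator. Then $A$ determines a real mixed Hodge structure on $V_{\mathbb{R}}$, in the following sense: the increasing filtration $W^A_\bullet$ of $V_{\mathbb{C}}$ is the complexification of a (unique) increasing filtration $W^{\mathbb{R}}_\bullet$ of $V_{\mathbb{R}}$, and the pair $(W^{\mathbb{R}}_\bullet, F_A^\bullet)$ is a real mixed Hodge structure on $V_{\mathbb{R}}$.
   Context: Lattice and Weierstrass function: let $\omega_1=1-i$, $\omega_2=1+i$, $\Lambda=\mathbb{Z}\omega_1+\mathbb{Z}\omega_2$, $\lambda_{p,q}=p\omega_1+q\omega_2$ for $p,q\in\mathbb{Z}$, and let $\sigma$ be the entire function $$\sigma(z)=z\prod_{(p,q)\neq(0,0)}\left(1-\frac{z}{\lambda_{p,q}}\right)\exp\left[\frac{z}{\lambda_{p,q}}+\frac12\left(\frac{z}{\lambda_{p,q}}\right)^2\right].$$ For $(m,n)\in\mathbb{Z}\times\mathbb{Z}$ put $\sigma_{m,n}(z)=\sigma(z)/(z-\lambda_{m,n})$, which is again an entire function. An entire function is applied to an endomorphism of a finite dimensional complex vector space via its power series. A $\sigma$-operator on $V_{\mathbb{C}}$ is $A\in\mathrm{End}_{\mathbb{C}}(V_{\mathbb{C}})$ with $\sigma(A)=0$. Complex conjugation on $V_{\mathbb{C}}=V_{\mathbb{R}}\otimes\mathbb{C}$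 is denoted by a bar, and $\overline{A}$ is the endomorphism $\overline{A}(x)=\overline{A(\overline{x})}$. For a $\sigma$-operator $A$ one has the eigenspace decomposition $V_{\mathbb{C}}=\bigoplus_{p,q}I_A^{p,q}$ with $I_A^{p,q}=\{x\in V_{\mathbb{C}}: Ax=\lambda_{p,q}x\}$, and one defines $$W_n^A=\bigoplus_{p+q\le n}I_A^{p,q},\qquad F_A^p=\bigoplus_{k\ge p,\ q\in\mathbb{Z}}I_A^{k,q}.$$ A $\sigma$-operator $A$ on $V_{\mathbb{C}}$ is weakly pseudo-real if $\sigma_{r,s}(A)(\overline{A}-A)\sigma_{p,q}(A)=0$ for all integers $p,q,r,s$ with $r+s\ge p+q$. A real mixed Hodge structure on $V_{\mathbb{R}}$ consists of a finite increasing filtration $W^{\mathbb{R}}_\bullet$ of $V_{\mathbb{R}}$ (weight filtration) and a finite decreasing filtration $F^\bullet$ of $V_{\mathbb{C}}$ (Hodge filtration) such that for every $n$ the filtration induced by $F^\bullet$ on the complexification of $\mathrm{Gr}^W_n(V_{\mathbb{R}})=W^{\mathbb{R}}_n/W^{\mathbb{R}}_{n-1}$ is a pure real Hodge structure of weight $n$. Filtrations are indexed by $\mathbb{Z}$; finite means equal to $0$ far enough in one direction and to the whole space far enough in the other. *)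

(* Defs.v *)
From HB Require Import structures.
From mathcomp Require Import all_boot all_order all_algebra.
From mathcomp Require Import complex.
From mathcomp Require Import all_classical all_reals all_analysis.
Import Order.TTheory GRing.Theory Num.Theory.
Import numFieldNormedType.Exports.
Set Implicit Arguments.
Unset Strict Implicit.
Unset Printing Implicit Defensive.
Local Open Scope classical_set_scope.
Local Open Scope complex_scope.
Local Open Scope ring_scope.

(* The usual topology of the complex field: that of its modulus. *)
HB.instance Definition _ (R : rcfType) :=
  NormedModule.copy R[i] (R[i] : numFieldType)^o.

Section EntireFunctions.
Variable R : realType.
Local Notation C := R[i].

Definition cexp (z : C) : C :=
  lim (series (fun k => z ^+ k / k`!%:R) @ \oo).

Definition lattice_pt (p q : int) : C :=
  p%:~R * (1 -i* 1) + q%:~R * (1 +i* 1).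

Definition weierstrass_factor (u : C) : C :=
  (1 - u) * cexp (u + u ^+ 2 / 2%:R).

(* The infinite product converges absolutely, so the order of the factors is
   irrelevant; it is taken as the limit over the squares |p|, |q| <= N. *)
Definition sigma_partial (z : C) (N : nat) : C :=
  \prod_(i < N.*2.+1) \prod_(j < N.*2.+1 |
      (i%:Z - N%:Z, j%:Z - N%:Z) != (0, 0))
    weierstrass_factor (z / lattice_pt (i%:Z - N%:Z) (j%:Z - N%:Z)).

Definition sigma (z : C) : C := z * lim (sigma_partial z @ \oo).

(* The removable singularity of sigma w / (w - lambda) is filled with its
   limit. *)
Definition sigma_div (m n : int) (z : C) : C :=
  let f := fun w => sigma w / (w - lattice_pt m n) in
  if z == lattice_pt m n then lim (f w @[w --> (lattice_pt m n)^']) else f z.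

(* The coefficients of the everywhere convergent power series with sum f; they
   are unique, and exist exactly when f is entire. *)
Definition power_series_coef (f : C -> C) : nat -> C :=
  get [set c : nat -> C |
    forall z, series (fun k => c k * z ^+ k) @ \oo --> f z].

Definition lfun_pow (V : vectType C) (A : 'End(V)) (k : nat) : 'End(V) :=
  iter k (comp_lfun A) \1%VF.

(* The sum of the power series of f at A; the limit is taken entrywise, in
   coordinates with respect to a basis of V. *)
Definition entire_lfun (f : C -> C) (V : vectType C) (A : 'End(V)) : 'End(V) :=
  let e := vbasis {:V} in
  passmx.hommx e e
    (lim (series (fun k =>
       power_series_coef f k *: passmx.mxof e e (lfun_pow A k)) @ \oo)).

End EntireFunctions.

Section Complexification.
Import VectorInternalTheory.
Variables (R : realType) (V : vectType R).

(* V tensored with the complex numbers; the pair (x, y) stands for x + i y. *)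
Definition cplx : Type := (V * V)%type.

HB.instance Definition _ := GRing.Zmodule.copy cplx (V * V)%type.

Fact cplx_addE (z w : cplx) : z + w = (z.1 + w.1, z.2 + w.2).
Proof. by []. Qed.

Definition cplx_scale (a : R[i]) (z : cplx) : cplx :=
  let: u +i* v := a in (u *: z.1 - v *: z.2, u *: z.2 + v *: z.1).

Fact cplx_scalerA a b z :
  cplx_scale a (cplx_scale b z) = cplx_scale (a * b) z.
Proof.
case: a b z => [a1 a2] [b1 b2] [x y]; apply: injective_projections => /=.
all: rewrite !scalerBr !scalerDr !scalerBl !scalerDl !scalerA ?opprD -!addrA.
all: by congr (_ + _); rewrite [RHS]addrC -addrA.
Qed.

Fact cplx_scale1r : left_id 1 cplx_scale.
Proof. by case=> x y; rewrite /cplx_scale /= !scale1r !scale0r subr0 addr0. Qed.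

Fact cplx_scalerDr : right_distributive cplx_scale +%R.
Proof.
move=> [a1 a2] [x1 y1] [x2 y2]; rewrite !cplx_addE.
by apply: injective_projections; rewrite /= !scalerDr ?opprD addrACA.
Qed.

Fact cplx_scalerDl z : {morph cplx_scale^~ z : a b / a + b}.
Proof.
case: z => [x y] [a1 a2] [b1 b2]; rewrite cplx_addE.
by apply: injective_projections; rewrite /= !scalerDl ?opprD addrACA.
Qed.

HB.instance Definition _ := GRing.Zmodule_isLmodule.Build R[i] cplx
  cplx_scalerA cplx_scale1r cplx_scalerDr cplx_scalerDl.

Fact cplx_vect_iso : Vector.axiom (dim V) cplx.
Proof.
exists (fun z : cplx => \row_j
    (v2r z.1 0 j +i* v2r z.2 0 j)).
  move=> [a1 a2] [x1 y1] [x2 y2]; apply/rowP => j; rewrite !mxE cplx_addE.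
  rewrite [(_ *: (_ : cplx)).1]/(a1 *: x1 - a2 *: y1).
  rewrite [(_ *: (_ : cplx)).2]/(a1 *: y1 + a2 *: x1) /=.
  by rewrite !linearD linearN !linearZ !mxE mulrN.
apply: (@Bijective _ _ _ (fun u : 'rV[R[i]]_(dim V) =>
    (r2v (map_mx (@complex.Re R) u),
     r2v (map_mx (@complex.Im R) u)) : cplx)).
  case=> x y; apply: injective_projections => /=; apply: v2r_inj;
  by rewrite r2vK; apply/rowP => j; rewrite !mxE.
move=> u; apply/rowP => j; rewrite !mxE /= !r2vK !mxE.
by case: (u 0 j).
Qed.

HB.instance Definition _ := Lmodule_hasFinDim.Build R[i] cplx cplx_vect_iso.

Definition cplx_inj (x : V) : cplx := (x, 0).

Definition cplx_conj (z : cplx) : cplx := (z.1, - z.2).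

Definition lfun_conj (A : 'End(cplx)) : 'End(cplx) :=
  linfun (fun x => cplx_conj (A (cplx_conj x))).

Definition vspace_conj (U : {vspace cplx}) : {vspace cplx} :=
  <<[seq cplx_conj x | x <- vbasis U]>>%VS.

Definition vspace_cplx (U : {vspace V}) : {vspace cplx} :=
  <<[seq cplx_inj x | x <- vbasis U]>>%VS.

Lemma cplx_scaleE a z : a *: z = cplx_scale a z.
Proof. by []. Qed.

Lemma cplx_conjK : involutive cplx_conj.
Proof. by case=> x y; rewrite /cplx_conj /= opprK. Qed.

Lemma cplx_conjD : {morph cplx_conj : z w / z + w}.
Proof. by case=> x y [x' y']; rewrite !cplx_addE /cplx_conj /= opprD. Qed.

Lemma cplx_conjZ a z : cplx_conj (a *: z) = conjc a *: cplx_conj z.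
Proof.
case: a z => a b [x y]; rewrite !cplx_scaleE /cplx_conj /cplx_scale /=.
by congr pair; rewrite ?scalerN ?scaleNr ?opprD ?opprK.
Qed.

Lemma cplx_conj0 : cplx_conj 0 = 0.
Proof. by rewrite /cplx_conj /= oppr0. Qed.

Lemma lfun_conjE A x : lfun_conj A x = cplx_conj (A (cplx_conj x)).
Proof.
pose f := fun x => cplx_conj (A (cplx_conj x)).
have lf : linear f.
  by move=> a u v; rewrite /f cplx_conjD cplx_conjZ linearP cplx_conjD
    cplx_conjZ conjcK.
pose lin := GRing.isLinear.Build _ _ _ _ f lf.
pose g : {linear cplx -> cplx} := HB.pack f lin.
by rewrite /lfun_conj -/f -[f]/(g : _ -> _) lfunE.
Qed.

Lemma memv_conj U z : (z \in vspace_conj U) = (cplx_conj z \in U).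
Proof.
have sub (X : {vspace cplx}) w : w \in X -> cplx_conj w \in vspace_conj X.
  move=> /coord_vbasis ->.
  rewrite (big_morph cplx_conj cplx_conjD cplx_conj0); apply: memv_suml => i _.
  rewrite cplx_conjZ memvZ // memv_span //; apply: map_f.
  by rewrite mem_nth // size_tuple.
apply/idP/idP => [|/sub]; last by rewrite cplx_conjK.
move=> /coord_span ->.
rewrite (big_morph cplx_conj cplx_conjD cplx_conj0); apply: memv_suml => i _.
rewrite cplx_conjZ memvZ //.
have /mapP[y yU ->] : [seq cplx_conj x | x <- vbasis U]`_i \in
    [seq cplx_conj x | x <- vbasis U] by rewrite mem_nth // size_map size_tuple.
by rewrite cplx_conjK vbasis_mem.
Qed.

Lemma memv_cplx U z : (z \in vspace_cplx U) = (z.1 \in U) && (z.2 \in U).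
Proof.
have sc a (x y : V) : a *: ((x, y) : cplx) = cplx_scale a (x, y) by [].
have sub x : x \in U -> cplx_inj x \in vspace_cplx U.
  move=> /coord_vbasis ->.
  have injD : {morph cplx_inj : x y / x + y}.
    by move=> u v; rewrite cplx_addE /= addr0.
  rewrite (big_morph cplx_inj injD (erefl _)); apply: memv_suml => i _.
  have -> (a : R) v : cplx_inj (a *: v) = a%:C *: cplx_inj v.
    by rewrite sc /cplx_scale /= !scale0r subr0 scaler0 addr0.
  rewrite memvZ // memv_span //; apply: map_f.
  by rewrite mem_nth // size_tuple.
apply/idP/andP => [|[z1 z2]].
  rewrite /vspace_cplx => /coord_span ->.
  elim/big_ind: _ => [|u v [u1 u2] [v1 v2]|i _].
  - by rewrite /= mem0v.
  - by rewrite cplx_addE /= !memvD.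
  have /mapP[y /vbasis_mem yU ->] :
      [seq cplx_inj x | x <- vbasis U]`_i \in
    [seq cplx_inj x | x <- vbasis U] by rewrite mem_nth // size_map size_tuple.
  case: (coord _ _ _) => a b; rewrite sc /cplx_scale /= !scaler0 subr0 add0r.
  by rewrite !memvZ.
have -> : z = cplx_inj z.1 + (0 +i* 1) *: cplx_inj z.2.
  case: z {z1 z2} => x y; rewrite sc /cplx_scale cplx_addE.
  apply: injective_projections => /=.
    by rewrite scale0r scaler0 subr0 addr0.
  by rewrite scale0r scale1r !add0r.
by rewrite memvD // ?memvZ // sub.
Qed.

End Complexification.

Definition lfun_cplx (R : realType) (V H : vectType R) (f : 'Hom(V, H)) :
    'Hom(cplx V, cplx H) :=
  linfun (fun z : cplx V => (f z.1, f z.2) : cplx H).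

Lemma lfun_cplxE (R : realType) (V H : vectType R) (f : 'Hom(V, H)) z :
  lfun_cplx f z = (f z.1, f z.2).
Proof.
pose h := fun z : cplx V => (f z.1, f z.2) : cplx H.
have lh : linear h.
  move=> [a b] [x y] [x' y']; rewrite !cplx_addE !cplx_scaleE /h /=.
  by rewrite !linearD !linearN !linearZ.
pose lin := GRing.isLinear.Build _ _ _ _ h lh.
pose g : {linear cplx V -> cplx H} := HB.pack h lin.
by rewrite /lfun_cplx -/h -[h]/(g : _ -> _) lfunE.
Qed.

Section Quotient.
Variables (R : realType) (V : vectType R) (U U' : {vspace V}).

(* The quotient U / U', for U' contained in U, realised on a complement of U'
   in U; quot_proj maps U onto it with kernel U'. *)
Definition quot : vectType R := subvs_of (U :\: U')%VS.

Definition quot_proj : 'Hom(V, quot) :=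
  linfun (vsproj (U :\: U')%VS \o addv_pi1 U U').

Lemma quot_projE x : vsval (quot_proj x) = addv_pi1 U U' x.
Proof. by rewrite lfunE /= vsprojK // memv_pi. Qed.

Lemma quot_proj_onto : (quot_proj @: U = fullv)%VS.
Proof.
apply/vspaceP => y; rewrite memvf; apply/memv_imgP.
have yD := subvsP y; exists (vsval y).
  by apply: (subvP (diffvSl U U')) yD.
apply: subvs_inj; rewrite quot_projE daddv_pi_id //.
by rewrite capv_diff.
Qed.

Lemma quot_proj_ker x : (U' <= U)%VS -> x \in U ->
  (quot_proj x == 0) = (x \in U').
Proof.
move=> U'U xU; rewrite -(inj_eq (@subvs_inj _ _ _)) quot_projE /=.
have xE : addv_pi1 U U' x + addv_pi2 U U' x = x.
  by rewrite addv_pi1_pi2 // (addv_idPl U'U).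
apply/eqP/idP => [x0|xU']; first by rewrite -xE x0 add0r memv_pi2.
have : addv_pi1 U U' x \in ((U :\: U') :&: U')%VS.
  rewrite memv_cap memv_pi /=.
  have -> : addv_pi1 U U' x = x - addv_pi2 U U' x by rewrite -{2}xE addrK.
  by rewrite memvB // memv_pi2.
by rewrite capv_diff memv0 => /eqP.
Qed.

End Quotient.

Section HodgeStructures.
Variable R : realType.

Definition increasing_filtration (K : fieldType) (V : vectType K)
    (W : int -> {vspace V}) : Prop :=
  forall m n : int, m <= n -> (W m <= W n)%VS.

Definition decreasing_filtration (K : fieldType) (V : vectType K)
    (F : int -> {vspace V}) : Prop :=
  forall m n : int, m <= n -> (F n <= F m)%VS.

Definition finite_increasing_filtration (K : fieldType) (V : vectType K)
    (W : int -> {vspace V}) : Prop :=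
  [/\ increasing_filtration W, exists m, W m = 0%VS & exists n, W n = fullv].

Definition finite_decreasing_filtration (K : fieldType) (V : vectType K)
    (F : int -> {vspace V}) : Prop :=
  [/\ decreasing_filtration F, exists m, F m = fullv & exists n, F n = 0%VS].

(* F is n-opposed to its complex conjugate: H_C is the direct sum of F^p and the
   conjugate of F^(n + 1 - p) for every p. *)
Definition pure_hodge_structure (H : vectType R) (n : int)
    (F : int -> {vspace cplx H}) : Prop :=
  finite_decreasing_filtration F /\
  forall p : int, (F p + vspace_conj (F (n + 1 - p)) = fullv)%VS /\
                  (F p :&: vspace_conj (F (n + 1 - p)) = 0)%VS.

Definition real_mixed_hodge_structure (V : vectType R)
    (W : int -> {vspace V}) (F : int -> {vspace cplx V}) : Prop :=
  [/\ finite_increasing_filtration W, finite_decreasing_filtration F &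
      forall n : int,
        pure_hodge_structure n (fun p =>
          lfun_cplx (quot_proj (W n) (W (n - 1))) @:
            (F p :&: vspace_cplx (W n)))%VS].

End HodgeStructures.

Section SigmaOperators.
Variables (R : realType) (V : vectType R).
Implicit Types A : 'End(cplx V).

Definition sigma_operator A : Prop := entire_lfun (@sigma R) A = 0.

Definition weakly_pseudo_real A : Prop :=
  sigma_operator A /\
  forall p q r s : int, p + q <= r + s ->
    (entire_lfun (@sigma_div R r s) A \o (lfun_conj A - A)
       \o entire_lfun (@sigma_div R p q) A)%VF = 0.

Definition eigen_I A (p q : int) : {vspace cplx V} :=
  passmx.leigenspace A (lattice_pt R p q).

(* Only finitely many eigenspaces are nonzero; \big[_/_]_(_ \in _) sums
   these. *)
Definition weight_filtration A (n : int) : {vspace cplx V} :=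
  \big[addv/0%VS]_(pq \in [set pq : int * int | pq.1 + pq.2 <= n])
    eigen_I A pq.1 pq.2.

Definition hodge_filtration A (p : int) : {vspace cplx V} :=
  \big[addv/0%VS]_(kq \in [set kq : int * int | p <= kq.1])
    eigen_I A kq.1 kq.2.

End SigmaOperators.

(* Main.v *)
Require Import Defs.
From mathcomp Require Import all_boot all_order all_algebra.
From mathcomp Require Import complex.
From mathcomp Require Import all_classical all_reals all_analysis.
From mathcomp Require Import ring lra zify.
Import Order.TTheory GRing.Theory Num.Theory.
Import numFieldNormedType.Exports.
Import Normc.
Set Implicit Arguments.
Unset Strict Implicit.
Unset Printing Implicit Defensive.
Local Open Scope classical_set_scope.
Local Open Scope ring_scope.

(** Why the theorem holds. The zeros of [sigma] are simple and are exactly the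
    lattice points. Hence [sigma A = 0] forces [A] to be diagonalisable with
    eigenvalues in the lattice, and the normalised values at [A] of the quotients
    [sigma_div p q] are the projections on the eigenspaces [I^{p,q}].

    The facts about [sigma] are obtained without complex integration. An infinite
    product is approximated by finite products of polynomials, compared in the
    norms that send a polynomial to the sum of [normc (c k) * r ^+ k] over its
    coefficients [c k] ([pnorm]). A comparison of products with real products
    ([dominated_prod]) makes these approximations a Cauchy sequence for every
    [r], and such a sequence converges to a function with an everywhere
    convergent power series ([entire_limit]). The result is a product theorem
    ([weierstrass_product]); the cubes of the inverses of the lattice points being
    summable ([lattice_sum_bound]), it applies to the product that defines
    [sigma] after the factor vanishing at a given lattice point has been divided
    by a linear one. So each [sigma_div p q] is entire and vanishes exactly at
    the other lattice points ([sigma_divP]).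

    For an entire [f], the operator [f A] acts on an eigenvector of eigenvalue
    [a] as the scalar [f a] ([entire_lfun_eigen]), and if [f z = (z - a) * g z]
    then [f A = g A (A - a)] ([entire_lfun_mul_linear], which rests on the
    uniqueness of the coefficients). Thus if [(A - a)^2 x = 0] and
    [w = (A - a) x] were nonzero, then [a] would be a lattice point and
    [sigma A x] would be the nonzero multiple [sigma_div a * w] of [w]
    ([generalized_eigen]). Diagonalisability follows ([eigen_decompositionP]).

    Let [x] be in [I^{p,q}], with [n = p + q]. Weak pseudo-reality says that
    [conj A x - lambda_{p,q} x] has weight at most [n - 1]. Its conjugate is
    [A y - lambda_{q,p} y] with [y] the conjugate of [x], because the conjugate
    of [lambda_{p,q}] is [lambda_{q,p}]. If [W_{n-1}] is stable under
    conjugation, the components of [y] of weight at least [n] are therefore all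
    zero except the one in [I^{q,p}]. By induction on [n], every [W_n] is stable
    under conjugation ([bar_weight]), hence is the complexification of a real
    subspace ([vspace_cplx_real_form]), and in the graded piece of weight [n]
    conjugation exchanges [I^{p,q}] and [I^{q,p}] ([bar_eigen]). This is the
    Hodge symmetry; the graded piece is the direct sum of the [I^{p,n-p}], and
    so is a pure Hodge structure of weight [n] ([graded_pure_hodge]). *)

(** * Convergence of complex sequences *)

Section ComplexSequences.
Variable R : realType.
Local Notation C := R[i].
Implicit Types (z w l : C) (u v : nat -> C) (b : nat -> R).

Lemma normc_abs z : `|z| = real_complex R (normc z).
Proof. by case: z. Qed.

Lemma normc_ge0 z : 0 <= normc z.
Proof. by case: z => a b; exact: sqrtr_ge0. Qed.

Lemma normcD z w : normc (z + w) <= normc z + normc w.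
Proof. exact: le_normcD. Qed.

Lemma normc_opp z : normc (- z) = normc z.
Proof. exact: normcN. Qed.

Lemma normc_distC z w : normc (z - w) = normc (w - z).
Proof. by rewrite -[in RHS]opprB normc_opp. Qed.

Lemma normcX z n : normc (z ^+ n) = normc z ^+ n.
Proof.
by elim: n => [|n IH]; rewrite ?normc1 // !exprS normcM IH.
Qed.

Lemma normc_nat n : normc (n%:R : C) = n%:R.
Proof.
apply: (@complexI R); rewrite -normc_abs.
by rewrite ger0_norm ?ler0n // rmorph_nat.
Qed.

Lemma normc_real (x : R) : 0 <= x -> normc (real_complex R x) = x.
Proof.
by move=> x0; rewrite /= expr0n /= addr0 sqrtr_sqr ger0_norm.
Qed.

Lemma normc_sum (I : Type) (s : seq I) (P : pred I) (F : I -> C) :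
  normc (\sum_(i <- s | P i) F i) <= \sum_(i <- s | P i) normc (F i).
Proof.
apply: (big_ind2 (fun x y => normc x <= y)) => //; first by rewrite normc0.
by move=> *; apply: le_trans (normcD _ _) _; exact: lerD.
Qed.

Lemma cvg_normcP u l : u @ \oo --> l <->
  forall e : R, 0 < e -> \forall n \near \oo, normc (l - u n) < e.
Proof.
split=> [/cvgrPdist_lt ul e e0|ul].
  have := ul (real_complex R e); rewrite (ltcR 0) => /(_ e0).
  by apply: filterS => n; rewrite normc_abs ltcR.
apply/cvgrPdist_lt => -[e e'] /=; rewrite ltcE /= => /andP[/eqP -> e0].
by apply: filterS (ul _ e0) => n; rewrite normc_abs => he; rewrite ltcE /= eqxx.
Qed.

Lemma cvg_normc_le b u l : (forall n, normc (l - u n) <= b n) ->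
  b @ \oo --> 0 -> u @ \oo --> l.
Proof.
move=> lub /cvgrPdist_lt b0; apply/cvg_normcP => e /b0.
apply: filterS => n; rewrite sub0r normrN; apply: le_lt_trans.
exact: le_trans (lub n) (ler_norm _).
Qed.

Lemma ler_normc_dist z w : `|normc z - normc w| <= normc (z - w).
Proof.
rewrite ler_distl; apply/andP; split; last first.
  by rewrite addrC -lerBlDr lerBlDl addrC; apply: le_trans (normcD _ _); rewrite subrK.
rewrite lerBlDr normc_distC addrC; apply: le_trans (normcD _ _).
by rewrite subrK.
Qed.

Lemma normc_cvg u l : u @ \oo --> l -> (fun n => normc (u n)) @ \oo --> normc l.
Proof.
move=> /cvg_normcP ul; apply/cvgrPdist_lt => e /ul; apply: filterS => n.
exact/le_lt_trans/ler_normc_dist.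
Qed.

Lemma normc_cvgB u l w : u @ \oo --> l ->
  (fun n => normc (u n - w)) @ \oo --> normc (l - w).
Proof.
by move=> ul; apply: (@normc_cvg (fun n => u n - w)); exact: (cvgB ul (cvg_cst w)).
Qed.

Lemma cvgcMl u l w : u @ \oo --> l -> (fun n => w * u n) @ \oo --> w * l.
Proof. by move=> ul; exact: (cvgM (cvg_cst w) ul). Qed.

Lemma cvgc_unique u l l' : u @ \oo --> l -> u @ \oo --> l' -> l = l'.
Proof. by move=> ul ul'; apply: cvg_unique ul ul'; exact: norm_hausdorff. Qed.

(** With [x] the real or the imaginary part, [x \o u + b] is nondecreasing and
    bounded, so [x \o u] is a difference of two convergent sequences. *)
Lemma cauchy_majorant b B u : (forall n, b n <= B) ->
  (forall n m, (n <= m)%N -> normc (u m - u n) <= b m - b n) ->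
  exists2 l, u @ \oo --> l & forall n, normc (l - u n) <= limn b - b n.
Proof.
move=> bB ub.
have b_nd : nondecreasing_seq b.
  by move=> n m nm; rewrite -subr_ge0; apply: le_trans (ub _ _ nm); exact: normc_ge0.
have b_cvg : cvgn b.
  by apply: nondecreasing_is_cvgn => //; exists B => _ [n _ <-].
have cvg_part (p : C -> R) : (forall z w, `|p z - p w| <= normc (z - w)) ->
    cvgn (fun n => p (u n)).
  move=> pN.
  have pu n m : (n <= m)%N -> `|p (u m) - p (u n)| <= b m - b n.
    by move=> nm; apply: le_trans (pN _ _) (ub _ _ nm).
  have -> : (fun n => p (u n)) = (fun n => (p (u n) + b n) - b n).
    by apply/funext => n; rewrite addrK.
  apply: is_cvgB => //; apply: nondecreasing_is_cvgn.
    by move=> n m /pu; rewrite ler_norml => /andP[+ _]; lra.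
  exists (p (u 0) + 2 * B - b 0) => _ [n _ <-].
  by move: (pu 0 n (leq0n n)) (bB n); rewrite ler_norml => /andP[_]; lra.
have sqr_le (x y : R) : `|x| <= Num.sqrt (x ^+ 2 + y ^+ 2).
  by rewrite -sqrtr_sqr ler_wsqrtr // lerDl sqr_ge0.
have sqrt_le_add (x y : R) : Num.sqrt (x ^+ 2 + y ^+ 2) <= `|x| + `|y|.
  apply: (@le_trans _ _ (Num.sqrt ((`|x| + `|y|) ^+ 2))).
    rewrite ler_wsqrtr // sqrrD !real_normK ?num_real // addrAC lerDl.
    by rewrite mulrn_wge0 // mulr_ge0.
  by rewrite sqrtr_sqr ger0_norm // addr_ge0.
have cRe : cvgn (fun n => complex.Re (u n)) by apply: cvg_part => -[? ?] [? ?] /=; exact: sqr_le.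
have cIm : cvgn (fun n => complex.Im (u n)).
  by apply: cvg_part => -[? ?] [? ?] /=; rewrite [X in Num.sqrt X]addrC; exact: sqr_le.
have dist0 (x : nat -> R) : cvgn x -> (fun n => `|limn x - x n|) @ \oo --> 0.
  move=> cx; rewrite -(@normr0 _ R) -(subrr (limn x)); apply: cvg_norm.
  by apply: cvgB => //; exact: cvg_cst.
pose l := Complex (limn (fun n => complex.Re (u n))) (limn (fun n => complex.Im (u n))).
have ul : u @ \oo --> l.
  apply: (@cvg_normc_le (fun n => `|complex.Re l - complex.Re (u n)| + `|complex.Im l - complex.Im (u n)|)).
    by move=> n; case: (u n) => x y; exact: sqrt_le_add.
  by rewrite -[0]addr0; apply: cvgD; exact: dist0.
exists l => // n.
have ulm : (fun m => normc (u m - u n)) @ \oo --> normc (l - u n).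
  exact: normc_cvgB.
apply: ler_cvg_to ulm (cvgB b_cvg (cvg_cst _)) _; near=> m.
by apply: ub; near: m; exact: nbhs_infty_ge.
Unshelve. all: by end_near.
Qed.

End ComplexSequences.
(** * Domination of finite products *)

Section DominatedProducts.
Variables (R : realType) (S : comNzRingType) (N : S -> R).
Hypotheses (N_ge0 : forall x, 0 <= N x) (N0 : N 0 = 0) (N1 : N 1 <= 1).
Hypothesis ND : forall x y, N (x + y) <= N x + N y.
Hypothesis NM : forall x y, N (x * y) <= N x * N y.

(** This relation between a pair of elements and a pair of majorants is stable
    under products, because
    [x1 * y1 - x2 * y2 = (x1 - x2) * y1 + x2 * (y1 - y2)] while
    [(a1 - a2) * b1 + a2 * (b1 - b2) = a1 * b1 - a2 * b2]. *)
Definition dominated (x1 x2 : S) (a1 a2 : R) :=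
  [/\ N x1 <= a1, N x2 <= a2 & N (x1 - x2) <= a1 - a2].

Lemma dominatedM x1 x2 a1 a2 y1 y2 b1 b2 :
  dominated x1 x2 a1 a2 -> dominated y1 y2 b1 b2 ->
  dominated (x1 * y1) (x2 * y2) (a1 * b1) (a2 * b2).
Proof.
move=> [x1a x2a xa] [y1b y2b yb]; split.
- by apply: le_trans (NM _ _) _; apply: ler_pM.
- by apply: le_trans (NM _ _) _; apply: ler_pM.
have -> : x1 * y1 - x2 * y2 = (x1 - x2) * y1 + x2 * (y1 - y2) by ring.
have -> : a1 * b1 - a2 * b2 = (a1 - a2) * b1 + a2 * (b1 - b2) by ring.
by apply: le_trans (ND _ _) _; apply: lerD; apply: le_trans (NM _ _) _;
  apply: ler_pM.
Qed.

Lemma dominated_prod (I : Type) (s : seq I) (P : pred I)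
    (x1 x2 : I -> S) (a1 a2 : I -> R) :
  (forall i, P i -> dominated (x1 i) (x2 i) (a1 i) (a2 i)) ->
  dominated (\prod_(i <- s | P i) x1 i) (\prod_(i <- s | P i) x2 i)
            (\prod_(i <- s | P i) a1 i) (\prod_(i <- s | P i) a2 i).
Proof.
move=> xa; elim: s => [|i s IH]; last first.
  by rewrite !big_cons; case: ifP => // Pi; apply: dominatedM => //; exact: xa.
rewrite !big_nil; split => //; by rewrite !subrr N0.
Qed.

End DominatedProducts.

(** * The majorant norm of a complex polynomial *)

Section PolyNorm.
Variable R : realType.
Local Notation C := R[i].
Implicit Types (p q : {poly C}) (r : R).

Definition pnorm r p : R := \sum_(k < size p) normc p`_k * r ^+ k.

Lemma pnorm_widen r p n : (size p <= n)%N ->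
  pnorm r p = \sum_(k < n) normc p`_k * r ^+ k.
Proof.
move=> pn; rewrite /pnorm (big_ord_widen _ (fun k => normc p`_k * r ^+ k) pn).
rewrite big_mkcond; apply: eq_bigr => k _; case: ltnP => // pk.
by rewrite nth_default // normc0 mul0r.
Qed.

Lemma pnorm0 r : pnorm r 0 = 0.
Proof. by rewrite /pnorm size_poly0 big_ord0. Qed.

Lemma pnormC r c : pnorm r c%:P = normc c.
Proof.
by rewrite (@pnorm_widen r _ 1) ?size_polyC ?leq_b1 // big_ord1 coefC mulr1.
Qed.

Lemma pnorm1 r : pnorm r 1 = 1.
Proof. by rewrite -polyC1 pnormC normc1. Qed.

Lemma pnormX r : pnorm r 'X = r.
Proof.
rewrite (@pnorm_widen r _ 2) ?size_polyX // big_ord_recr big_ord1 /=.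
by rewrite !coefX normc0 normc1 mul0r add0r mul1r.
Qed.

Lemma pnormD r p q : 0 <= r -> pnorm r (p + q) <= pnorm r p + pnorm r q.
Proof.
move=> r0; pose n := maxn (size p) (size q).
rewrite (pnorm_widen _ (size_polyD p q)).
rewrite (pnorm_widen _ (leq_maxl (size p) (size q))).
rewrite (pnorm_widen _ (leq_maxr (size p) (size q))) -big_split /=.
apply: ler_sum => k _; rewrite -mulrDl coefD ler_wpM2r ?exprn_ge0 //.
exact: normcD.
Qed.

Lemma pnorm_ge0 r p : 0 <= r -> 0 <= pnorm r p.
Proof.
by move=> r0; apply: sumr_ge0 => k _; rewrite mulr_ge0 ?exprn_ge0 ?normc_ge0.
Qed.

Lemma pnormZ r a p : pnorm r (a *: p) = normc a * pnorm r p.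
Proof.
rewrite (pnorm_widen _ (size_scale_leq a p)) mulr_sumr.
by apply: eq_bigr => k _; rewrite coefZ normcM mulrA.
Qed.

Lemma pnormN r p : pnorm r (- p) = pnorm r p.
Proof. by rewrite -scaleN1r pnormZ normc_opp normc1 mul1r. Qed.

Lemma pnorm_sum r (I : Type) (s : seq I) (P : pred I) (F : I -> {poly C}) :
  0 <= r ->
  pnorm r (\sum_(i <- s | P i) F i) <= \sum_(i <- s | P i) pnorm r (F i).
Proof.
move=> r0; apply: (big_ind2 (fun x y => pnorm r x <= y)) => //.
  by rewrite pnorm0.
by move=> *; apply: le_trans (pnormD _ _ r0) _; exact: lerD.
Qed.

Lemma pnormMX r p : pnorm r (p * 'X) = r * pnorm r p.
Proof.
rewrite (@pnorm_widen r _ (size p).+1); last first.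
  by rewrite (leq_trans (size_polyMleq _ _)) // size_polyX addn2.
rewrite big_ord_recl coefMX normc0 mul0r add0r mulr_sumr.
by apply: eq_bigr => k _; rewrite coefMX /= exprS mulrCA.
Qed.

Lemma pnormM r p q : 0 <= r -> pnorm r (p * q) <= pnorm r p * pnorm r q.
Proof.
move=> r0; have pMXn k : pnorm r (q * 'X^k) = r ^+ k * pnorm r q.
  elim: k => [|k IH]; first by rewrite !expr0 mulr1 mul1r.
  by rewrite exprSr mulrA pnormMX IH exprS mulrA.
rewrite -[p in p * q]coefK poly_def mulr_suml mulr_suml.
apply: le_trans (pnorm_sum _ _ _ r0) _; apply: ler_sum => k _.
by rewrite -scalerAl pnormZ ['X^_ * q]mulrC pMXn mulrA.
Qed.

Lemma pnormXn r p k : 0 <= r -> pnorm r (p ^+ k) <= pnorm r p ^+ k.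
Proof.
move=> r0; elim: k => [|k IH]; first by rewrite !expr0 pnorm1.
rewrite !exprS; apply: le_trans (pnormM _ _ r0) _.
by rewrite ler_wpM2l // pnorm_ge0.
Qed.

Lemma normc_horner_le p z : normc p.[z] <= pnorm (normc z) p.
Proof.
rewrite horner_coef; apply: le_trans (normc_sum _ _ _) _.
by apply: ler_sum => k _; rewrite normcM normcX.
Qed.

Lemma pnorm_prefix r p n : 0 <= r ->
  \sum_(k < n) normc p`_k * r ^+ k <= pnorm r p.
Proof.
move=> r0; rewrite (pnorm_widen _ (leq_maxl (size p) n)).
rewrite (big_ord_widen _ (fun k => normc p`_k * r ^+ k) (leq_maxr (size p) n)).
rewrite big_mkcond; apply: ler_sum => k _; case: ifP => // _.
by rewrite mulr_ge0 ?exprn_ge0 ?normc_ge0.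
Qed.

(** The substitution contracts the coefficient of degree [k] by
    [normc a ^+ k], which is at most [normc a ^+ d] on the nonzero terms. *)
Lemma pnorm_comp_scale d r a p : 0 <= r -> normc a <= 1 ->
  (forall k, (k < d)%N -> p`_k = 0) ->
  pnorm r (p \Po (a *: 'X)) <= normc a ^+ d * pnorm r p.
Proof.
move=> r0 a1 pd; rewrite comp_polyE mulr_sumr.
apply: le_trans (pnorm_sum _ _ _ r0) _; apply: ler_sum => k _.
rewrite pnormZ; case: (ltnP k d) => [/pd -> | kd].
  by rewrite normc0 !mul0r mulr0.
rewrite exprZn pnormZ mulrCA normcX.
have -> : pnorm r 'X^k = r ^+ k.
  elim: (nat_of_ord k) => [|j IH]; first by rewrite !expr0 pnorm1.
  by rewrite exprSr pnormMX IH exprS.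
rewrite ler_wpM2r ?mulr_ge0 ?exprn_ge0 ?normc_ge0 //.
by apply: ler_wiXn2l; rewrite ?normc_ge0.
Qed.

End PolyNorm.
Lemma cvg_sum_seq (K : numFieldType) (V : normedModType K) (I : Type)
    (r : seq I) (u : nat -> I -> V) (l : I -> V) :
  (forall k, (fun m => u m k) @ \oo --> l k) ->
  (fun m => \sum_(k <- r) u m k) @ \oo --> \sum_(k <- r) l k.
Proof.
move=> ul; elim: r => [|k r IH].
  by rewrite big_nil; under eq_fun do rewrite big_nil; exact: cvg_cst.
rewrite big_cons; under eq_fun do rewrite big_cons.
exact: (cvgD (ul k) IH).
Qed.

(** * Power series as limits of polynomials *)

Section EntireLimits.
Variable R : realType.
Local Notation C := R[i].

Definition expansion (f : C -> C) (c : nat -> C) :=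
  forall z, series (fun k => c k * z ^+ k) @ \oo --> f z.

(** A sequence of polynomials that is Cauchy for every majorant norm converges
    both pointwise and coefficientwise, and the coefficientwise limits are the
    coefficients of the pointwise limit: the partial sums of the limit series
    inherit the Cauchy estimate. *)
Lemma entire_limit (P : nat -> {poly C}) (b : R -> nat -> R) (B : R -> R) :
  (forall r n, 0 <= r -> b r n <= B r) ->
  (forall r n m, 0 <= r -> (n <= m)%N -> pnorm r (P m - P n) <= b r m - b r n) ->
  exists2 H : C -> C, forall z, (fun n => (P n).[z]) @ \oo --> H z &
    exists c, expansion H c.
Proof.
move=> bB Pb.
have /(@choice nat C)[c Pc] : forall k, exists l : C, (fun n => (P n)`_k) @ \oo --> l.
  move=> k; have [n|n m nm|l] := @cauchy_majorant R (b 1) (B 1) (fun n => (P n)`_k).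
  - exact: bB.
  - apply: le_trans (Pb _ _ _ ler01 nm); apply: le_trans (pnorm_prefix _ k.+1 ler01).
    rewrite big_ord_recr /= coefB expr1n mulr1 lerDr.
    by apply: sumr_ge0 => i _; rewrite expr1n mulr1 normc_ge0.
  - by exists l.
have /(@choice C C)[H PH] : forall z, exists l : C, (fun n => (P n).[z]) @ \oo --> l /\
    forall n, normc (l - (P n).[z]) <= limn (b (normc z)) - b (normc z) n.
  move=> z; have [n|n m nm|l] := @cauchy_majorant R (b (normc z)) (B (normc z)) (fun n => (P n).[z]).
  - exact: bB (normc_ge0 z).
  - apply: le_trans (Pb _ _ _ (normc_ge0 z) nm).
    by rewrite -hornerN -hornerD; exact: normc_horner_le.
  - by exists l.
exists H => [z|]; first by have [] := PH z.
exists c => z; set r := normc z; have r0 : 0 <= r by exact: normc_ge0.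
have b_nd : nondecreasing_seq (b r).
  by move=> n m nm; rewrite -subr_ge0; apply: le_trans (Pb _ _ _ r0 nm); exact: pnorm_ge0.
have b_cvg : cvgn (b r).
  by apply: nondecreasing_is_cvgn => //; exists (B r) => _ [n _ <-]; exact: bB.
have close n K : (size (P n) <= K)%N ->
    normc (\sum_(0 <= k < K) c k * z ^+ k - (P n).[z]) <= limn (b r) - b r n.
  move=> nK.
  have Pz : (P n).[z] = \sum_(0 <= k < K) (P n)`_k * z ^+ k.
    by rewrite (horner_coef_wide _ nK) big_mkord.
  have lim_m : (fun m => normc (\sum_(0 <= k < K) (P m)`_k * z ^+ k - (P n).[z]))
      @ \oo --> normc (\sum_(0 <= k < K) c k * z ^+ k - (P n).[z]).
    apply: normc_cvgB; apply: (@cvg_sum_seq _ C) => k.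
    exact: (cvgM (Pc k) (cvg_cst _)).
  apply: ler_cvg_to lim_m (cvgB b_cvg (cvg_cst _)) _; near=> m.
  have nm : (n <= m)%N by near: m; exact: nbhs_infty_ge.
  apply: le_trans (Pb _ _ _ r0 nm); apply: le_trans (pnorm_prefix _ K r0).
  rewrite Pz -sumrB big_mkord; apply: le_trans (normc_sum _ _ _) _.
  by apply: ler_sum => k _; rewrite -mulrBl -coefB normcM normcX.
apply/cvg_normcP => e e0.
have e20 : 0 < e / 2 by rewrite divr_gt0.
have [n _ bn] : \forall n \near \oo, `|limn (b r) - b r n| < e / 2.
  by move/cvgrPdist_lt : b_cvg; exact.
exists (size (P n)) => // K /= nK; rewrite /series /=.
have [_ /(_ n) Hn] := PH z; move: (close _ _ nK) => Sn.
have := le_lt_trans (ler_norm _) (bn n (leqnn n)).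
have := normcD (H z - (P n).[z]) ((P n).[z] - \sum_(0 <= k < K) c k * z ^+ k).
rewrite addrA subrK => h1 h2; apply: le_lt_trans h1 _.
rewrite [X in _ + X]normc_distC; rewrite -/r in Hn; lra.
Unshelve. all: by end_near.
Qed.

End EntireLimits.

(** * The complex exponential *)

Section ComplexExponential.
Variable R : realType.
Local Notation C := R[i].

Lemma series_exp_le (x : R) n : 0 <= x -> series (exp_coeff x) n <= expR x.
Proof.
move=> x0; apply: nondecreasing_cvgn_le; last exact: is_cvg_series_exp_coeff.
apply: nondecreasing_series => k _ _; exact: exp_coeff_ge0.
Qed.

Lemma normc_exp_term (z : C) k : normc (z ^+ k / k`!%:R) = exp_coeff (normc z) k.
Proof. by rewrite normcM normcX normcV normc_nat. Qed.

Lemma cexp_cvg (z : C) : series (fun k => z ^+ k / k`!%:R) @ \oo --> cexp z.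
Proof.
have [n|n m nm|l ul _] := @cauchy_majorant R (series (exp_coeff (normc z)))
  (expR (normc z)) (series (fun k => z ^+ k / k`!%:R)).
- exact: series_exp_le (normc_ge0 z).
- rewrite !sub_series_geq //; apply: le_trans (normc_sum _ _ _) _.
  by apply: ler_sum => k _; rewrite normc_exp_term.
by rewrite /cexp (cvg_lim (@norm_hausdorff _ C) ul).
Qed.

(** The second sum collects the terms of total degree at least [n]. *)
Lemma truncated_product (F : comNzRingType) (f g : nat -> F) n :
  (\sum_(0 <= i < n) f i) * (\sum_(0 <= j < n) g j) =
  \sum_(0 <= k < n) \sum_(0 <= j < k.+1) f (k - j)%N * g j +
  \sum_(0 <= j < n) \sum_(0 <= i < n | ~~ (i < n - j)%N) f i * g j.
Proof.
have -> : \sum_(0 <= k < n) \sum_(0 <= j < k.+1) f (k - j)%N * g j =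
    \sum_(0 <= j < n) \sum_(0 <= i < n | (i < n - j)%N) f i * g j.
  transitivity (\sum_(0 <= k < n) \sum_(0 <= j < n | (j <= k)%N)
      f (k - j)%N * g j).
    apply: eq_big_nat => k /andP[_ kn]; rewrite (big_nat_widen 0 k.+1 n) //.
  rewrite (exchange_big_dep_nat xpredT) //=; apply: eq_big_nat => j /andP[_ jn].
  rewrite -(big_nat_widen 0 (n - j) n xpredT (fun i => f i * g j)) ?leq_subr //.
  rewrite -(big_nat_widenl j 0 n xpredT (fun i => f (i - j)%N * g j)) //.
  by rewrite -[X in \sum_(X <= _ < _) _]add0n big_addn; apply: eq_bigr => i _;
    rewrite addnK.
rewrite -big_split /= mulr_sumr; apply: eq_bigr => j _.
by rewrite mulr_suml (bigID (fun i => (i < n - j)%N)).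
Qed.

Lemma exp_sumM (F : numFieldType) (x y : F) n :
  (\sum_(0 <= i < n) x ^+ i / i`!%:R) * (\sum_(0 <= j < n) y ^+ j / j`!%:R) =
  \sum_(0 <= k < n) (x + y) ^+ k / k`!%:R +
  \sum_(0 <= j < n) \sum_(0 <= i < n | ~~ (i < n - j)%N)
    x ^+ i / i`!%:R * (y ^+ j / j`!%:R).
Proof.
rewrite truncated_product; congr (_ + _); apply: eq_bigr => k _.
rewrite exprDn mulr_suml big_mkord; apply: eq_bigr => -[j /=]; rewrite ltnS => jk _.
have fact0 i : i`!%:R != 0 :> F by rewrite pnatr_eq0 -lt0n fact_gt0.
rewrite -mulr_natr -(bin_fact jk) !natrM.
by field; rewrite !fact0 pnatr_eq0 -lt0n bin_gt0 jk.
Qed.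

(** The terms of [exp_sumM] of total degree at least [n] are bounded by the same
    terms for the moduli of [z] and [w], whose sum tends to [0] by the functional
    equation of the real exponential. *)
Lemma cexpD (z w : C) : cexp (z + w) = cexp z * cexp w.
Proof.
apply: (@cvgc_unique R (series (fun k => (z + w) ^+ k / k`!%:R))); first exact: cexp_cvg.
set Sz := series (fun k => z ^+ k / k`!%:R).
set Sw := series (fun k => w ^+ k / k`!%:R).
have SzSw : (fun n => Sz n * Sw n) @ \oo --> cexp z * cexp w.
  exact: (cvgM (@cexp_cvg z) (@cexp_cvg w)).
set Szw := series _.
pose x := normc z; pose y := normc w.
pose b n := series (exp_coeff x) n * series (exp_coeff y) n - series (exp_coeff (x + y)) n.
have b0 : b @ \oo --> 0.
  rewrite -(subrr (expR (x + y))) [X in _ --> X - _]expRD.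
  by apply: cvgB; [apply: cvgM|]; exact: is_cvg_series_exp_coeff.
have D n : normc (Sz n * Sw n - Szw n) <= b n.
  rewrite /b /Sz /Sw /Szw /series /= !exp_sumM [X in normc X]addrC addKr.
  rewrite [leRHS]addrC addKr.
  apply: le_trans (normc_sum _ _ _) _; apply: ler_sum => j _.
  apply: le_trans (normc_sum _ _ _) _; apply: ler_sum => i _.
  by rewrite normcM !normc_exp_term.
have D0 : (fun n => Sz n * Sw n - Szw n) @ \oo --> (0 : C).
  by apply: cvg_normc_le b0 => n; rewrite sub0r normc_opp.
have -> : Szw = (fun n => Sz n * Sw n - (Sz n * Sw n - Szw n)).
  by apply/funext => n; rewrite opprB addrC subrK.
by rewrite -[cexp z * cexp w]subr0; exact: (cvgB SzSw D0).
Qed.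

Lemma cexp0 : cexp 0 = 1 :> C.
Proof.
have := @cexp_cvg 0; rewrite -cvg_shiftS => /cvgc_unique; apply.
rewrite (_ : [sequence _]_n = fun=> 1); first exact: (cvg_cst (1 : C)).
apply/funext => n /=; rewrite /series /= big_nat_recl // expr0 divr1 big1 ?addr0 //.
by move=> i _; rewrite expr0n /= mul0r.
Qed.

Lemma cexp_neq0 (z : C) : cexp z != 0.
Proof.
apply/eqP => z0; have := cexpD z (- z); rewrite subrr cexp0 z0 mul0r.
exact/eqP/oner_neq0.
Qed.

End ComplexExponential.
(** * Infinite products of entire functions *)

Section InfiniteProducts.
Variables (R : realType) (I : eqType) (s : nat -> seq I).
Local Notation C := R[i].
Hypothesis s_uniq : forall n, uniq (s n).
Hypothesis s_sub : forall n m, (n <= m)%N -> {subset s n <= s m}.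

Lemma big_nested (S : Type) (idx : S) (op : Monoid.com_law idx) (f : I -> S) n m :
  (n <= m)%N ->
  \big[op/idx]_(i <- s n) f i =
  \big[op/idx]_(i <- s m) (if i \in s n then f i else idx).
Proof.
move=> nm; rewrite -big_mkcond -[RHS]big_filter; apply: perm_big.
apply: uniq_perm => // [|i]; first exact: filter_uniq.
rewrite mem_filter andb_idr //; exact: s_sub.
Qed.

Lemma prod1D_ge1 (a : I -> R) (r : seq I) : (forall i, 0 <= a i) ->
  1 <= \prod_(i <- r) (1 + a i).
Proof.
move=> a0; elim: r => [|i r IH]; first by rewrite big_nil.
by rewrite big_cons mulr_ege1 // lerDl.
Qed.

Lemma prod1D_le_expR (a : I -> R) (r : seq I) : (forall i, 0 <= a i) ->
  \prod_(i <- r) (1 + a i) <= expR (\sum_(i <- r) a i).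
Proof.
move=> a0; rewrite expR_sum; apply: ler_prod => i _.
by rewrite expR_ge1Dx addr_ge0.
Qed.

(** Raising the factors one at a time costs at most the corresponding
    difference times the larger product. *)
Lemma prod1D_sub_le (a b : I -> R) (r : seq I) : (forall i, 0 <= a i <= b i) ->
  \prod_(i <- r) (1 + b i) - \prod_(i <- r) (1 + a i) <=
  (\sum_(i <- r) (b i - a i)) * \prod_(i <- r) (1 + b i).
Proof.
move=> ab; elim: r => [|i r IH]; first by rewrite !big_nil; lra.
rewrite !big_cons.
have b0 j : 0 <= b j by have /andP[] := ab j; exact: le_trans.
have a0 j : 0 <= a j by have /andP[] := ab j.
have abi := ab i; have B1 := prod1D_ge1 r b0; have A1 := prod1D_ge1 r a0.
have AB : \prod_(j <- r) (1 + a j) <= \prod_(j <- r) (1 + b j).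
  by apply: ler_prod => j _; rewrite addr_ge0 // lerD2l; have /andP[] := ab j.
move: (\sum_(j <- r) _) (\prod_(j <- r) (1 + b j)) (\prod_(j <- r) (1 + a j))
  B1 A1 AB IH => S B A B1 A1 AB IH.
have {}b0 := b0 i; have {}a0 := a0 i; have /andP[_ abi'] := abi.
have h1 : 0 <= (1 + a i) * (S * B - (B - A)).
  by rewrite mulr_ge0 ?subr_ge0 // addr_ge0.
have h2 : 0 <= (b i - a i) * (b i * B).
  by rewrite !mulr_ge0 ?subr_ge0 // (le_trans ler01).
have h3 : 0 <= (b i - a i) * (S * B).
  by rewrite mulr_ge0 ?subr_ge0 // (le_trans _ IH) // subr_ge0.
lra.
Qed.

(** * Infinite products of complex numbers *)

Lemma normc_dominated1 (f : C) (x : R) : normc (f - 1) <= x ->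
  dominated (@normc R) f 1 (1 + x) 1.
Proof.
move=> fx; split; rewrite ?normc1 //; last by rewrite [leRHS]addrC addKr.
rewrite -[f](subrK 1) addrC; apply: le_trans (normcD _ _) _.
by rewrite normc1 lerD2l.
Qed.

(** The relative change [normc (Q m / Q n - 1)] of the partial products is at most
    [q m / q n - 1], where [q n] is the partial product of the [1 + a i]. Since
    [q] converges to a positive limit, this is small for large [n], so that the
    [Q m] cannot tend to [0]. *)
Lemma infinite_prod_neq0 (f : I -> C) (a : I -> R) (B : R) (l : C) :
  (forall i, normc (f i - 1) <= a i) ->
  (forall n, \sum_(i <- s n) a i <= B) -> (forall i, f i != 0) ->
  (fun n => \prod_(i <- s n) f i) @ \oo --> l -> l != 0.
Proof.
move=> fa aB f0 fl.
have a0 i : 0 <= a i by apply: le_trans (fa i); exact: normc_ge0.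
pose q n := \prod_(i <- s n) (1 + a i); pose Q n := \prod_(i <- s n) f i.
have q1 n : 1 <= q n by exact: prod1D_ge1.
have q_nd : nondecreasing_seq q.
  move=> n m nm; rewrite /q (big_nested _ _ nm); apply: ler_prod => i _.
  by case: ifP => _; rewrite ?ler01 ?lexx ?lerDl ?addr_ge0 ?a0.
have q_cvg : cvgn q.
  apply: nondecreasing_is_cvgn => //; exists (expR B) => _ [n _ <-].
  by apply: le_trans (prod1D_le_expR _ a0) _; rewrite ler_expR.
have Qq n m : (n <= m)%N -> normc (Q m - Q n) * q n <= normc (Q n) * (q m - q n).
  move=> nm; pose g i := if i \in s n then 1 else f i.
  pose c i := if i \in s n then 1 else 1 + a i.
  have Qm : Q m = Q n * \prod_(i <- s m) g i.
    rewrite /Q (big_nested _ _ nm) -big_split; apply: eq_bigr => i _ /=.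
    by rewrite /g; case: ifP; rewrite ?mulr1 ?mul1r.
  have qm : q m = q n * \prod_(i <- s m) c i.
    rewrite /q (big_nested _ _ nm) -big_split; apply: eq_bigr => i _ /=.
    by rewrite /c; case: ifP; rewrite ?mulr1 ?mul1r.
  have [] : dominated (@normc R) (\prod_(i <- s m) g i) (\prod_(i <- s m) 1)
      (\prod_(i <- s m) c i) (\prod_(i <- s m) 1).
    apply: dominated_prod; rewrite ?normc0 ?normc1 //.
    - exact: normc_ge0.
    - exact: normcD.
    - by move=> x y; rewrite normcM.
    move=> i _; rewrite /g /c; case: ifP => _; last exact: normc_dominated1.
    by split; rewrite ?normc1 // !subrr normc0.
  rewrite !big1_eq => _ _ gc.
  have -> : Q m - Q n = Q n * (\prod_(i <- s m) g i - 1) by rewrite Qm; ring.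
  have -> : q m - q n = q n * (\prod_(i <- s m) c i - 1) by rewrite qm; ring.
  rewrite normcM -mulrA ler_wpM2l ?normc_ge0 // mulrC ler_wpM2l //.
  exact: le_trans (q1 n).
apply/eqP => l0; rewrite l0 in fl.
have lim_le n : q n <= limn q - q n.
  have Qn0 : 0 < normc (Q n).
    rewrite lt0r normc_ge0 andbT; apply/eqP => /eq0_normc/eqP.
    by rewrite prodf_seq_eq0 => /hasP[i _]; rewrite (negPf (f0 i)).
  have h1 : (fun m => normc (Q m - Q n) * q n) @ \oo --> normc (Q n) * q n.
    by apply: cvgMr_tmp; have := @normc_cvgB _ _ _ (Q n) fl; rewrite sub0r normc_opp.
  have h2 : (fun m => normc (Q n) * (q m - q n)) @ \oo --> normc (Q n) * (limn q - q n).
    by apply: cvgMl_tmp; apply: cvgB => //; exact: cvg_cst.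
  rewrite -(ler_pM2l Qn0); apply: ler_cvg_to h1 h2 _; near=> m.
  by apply: Qq; near: m; exact: nbhs_infty_ge.
have : limn q <= limn q - limn q.
  apply: ler_cvg_to q_cvg (cvgB (cvg_cst _) q_cvg) _.
  by near=> n; exact: lim_le.
have := nondecreasing_cvgn_le q_nd q_cvg 0; have := q1 0%N; lra.
Unshelve. all: by end_near.
Qed.

(** * Weierstrass products *)

(** [T n i] are polynomial approximations of the [i]-th factor [f i], whose
    distances to [1] are summable in [i], uniformly in [n]. *)
Variables (a : I -> R) (B : R) (T : nat -> I -> {poly C}).
Variables (mu : R -> nat -> R) (K : R -> R) (f : I -> C -> C).
Hypotheses (a_ge0 : forall i, 0 <= a i).
Hypothesis aB : forall n, \sum_(i <- s n) a i <= B.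
Hypothesis mu_ge0 : forall r n, 0 <= r -> 0 <= mu r n.
Hypothesis mu_nd : forall r, 0 <= r -> nondecreasing_seq (mu r).
Hypothesis muK : forall r n, 0 <= r -> mu r n <= K r.
Hypothesis T1 : forall r n i, 0 <= r -> pnorm r (T n i - 1) <= a i * mu r n.
Hypothesis T_cauchy : forall r n m i, 0 <= r -> (n <= m)%N ->
  pnorm r (T m i - T n i) <= a i * (mu r m - mu r n).
Hypothesis Tf : forall i z, (fun n => (T n i).[z]) @ \oo --> f i z.

Let pi r n := \prod_(i <- s n) (1 + a i * mu r n).

Let pi_le r n : 0 <= r -> pi r n <= expR (B * K r).
Proof.
move=> r0; apply: le_trans (prod1D_le_expR _ _) _ => [i|].
  by rewrite mulr_ge0 // mu_ge0.
rewrite ler_expR -mulr_suml; apply: ler_pM => //; last exact: muK.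
  exact: sumr_ge0.
exact: mu_ge0.
Qed.

Let P_cauchy r n m : 0 <= r -> (n <= m)%N ->
  pnorm r (\prod_(i <- s m) T m i - \prod_(i <- s n) T n i) <= pi r m - pi r n.
Proof.
move=> r0 nm; rewrite /pi !(big_nested _ _ nm).
suff [] : dominated (pnorm r) (\prod_(i <- s m) T m i)
    (\prod_(i <- s m) if i \in s n then T n i else 1)
    (\prod_(i <- s m) (1 + a i * mu r m))
    (\prod_(i <- s m) if i \in s n then 1 + a i * mu r n else 1) by [].
have T1' k i : pnorm r (T k i) <= 1 + a i * mu r k.
  rewrite -[T k i](subrK 1) addrC; apply: le_trans (pnormD _ _ r0) _.
  by rewrite pnorm1 lerD2l T1.
apply: dominated_prod; rewrite ?pnorm0 ?pnorm1 //.
- by move=> p; exact: pnorm_ge0.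
- by move=> p q; exact: pnormD.
- by move=> p q; exact: pnormM.
move=> i _; case: ifP => _; split; rewrite ?pnorm1 //.
  have -> : 1 + a i * mu r m - (1 + a i * mu r n) = a i * (mu r m - mu r n) by ring.
  exact: T_cauchy.
by rewrite [leRHS]addrC addKr T1.
Qed.

Let f_near z i n : let r := normc z in
  normc (f i z - 1) <= a i * limn (mu r) /\
  normc (f i z - (T n i).[z]) <= a i * (limn (mu r) - mu r n).
Proof.
move=> r; have r0 : 0 <= r by exact: normc_ge0.
have mu_cvg : cvgn (mu r).
  by apply: nondecreasing_is_cvgn; [exact: mu_nd|exists (K r) => _ [k _ <-]; exact: muK].
split.
  have lim1 : (fun m => normc ((T m i).[z] - 1)) @ \oo --> normc (f i z - 1).
    exact: normc_cvgB.
  have lim2 : (fun m => a i * mu r m) @ \oo --> a i * limn (mu r).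
    exact: cvgMl_tmp.
  apply: ler_cvg_to lim1 lim2 _; near=> m; apply: le_trans (T1 m i r0).
  by rewrite -[1](hornerC 1 z) -hornerN -hornerD; exact: normc_horner_le.
have lim1 : (fun m => normc ((T m i).[z] - (T n i).[z])) @ \oo -->
    normc (f i z - (T n i).[z]).
  exact: normc_cvgB.
have lim2 : (fun m => a i * (mu r m - mu r n)) @ \oo -->
    a i * (limn (mu r) - mu r n).
  by apply: cvgMl_tmp; apply: cvgB => //; exact: cvg_cst.
apply: ler_cvg_to lim1 lim2 _; near=> m.
have nm : (n <= m)%N by near: m; exact: nbhs_infty_ge.
apply: le_trans (T_cauchy i r0 nm).
by rewrite -hornerN -hornerD; exact: normc_horner_le.
Unshelve. all: by end_near.
Qed.

(** The products of the approximations [T n i] are dominated by the real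
    products of [1 + a i * mu r n], which increase with [n] and are bounded by
    the exponential of [B * K r]; so they form a Cauchy sequence for every
    majorant norm. Replacing [T n i] by its limit [f i] changes the product over
    [s n] by a quantity that tends to [0]. *)
Theorem weierstrass_product : exists H : C -> C,
  [/\ exists c, expansion H c,
      forall z, (fun n => \prod_(i <- s n) f i z) @ \oo --> H z &
      forall z, (forall i, f i z != 0) -> H z != 0].
Proof.
have [H PH Hc] := @entire_limit R (fun n => \prod_(i <- s n) T n i) pi
  (fun r => expR (B * K r)) pi_le P_cauchy.
have fH z : (fun n => \prod_(i <- s n) f i z) @ \oo --> H z.
  set r := normc z; have r0 : 0 <= r by exact: normc_ge0.
  have mu_cvg : cvgn (mu r).
    by apply: nondecreasing_is_cvgn; [exact: mu_nd|exists (K r) => _ [k _ <-]; exact: muK].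
  have mu_le n : mu r n <= limn (mu r) by exact: nondecreasing_cvgn_le (mu_nd r0) _ _.
  have mu0 : 0 <= limn (mu r) by apply: le_trans (mu_le 0%N); exact: mu_ge0.
  have muK' : limn (mu r) <= K r by apply: limr_le => //; near=> n; exact: muK.
  have B0 : 0 <= B by apply: le_trans (aB 0); exact: sumr_ge0.
  pose e n := B * (limn (mu r) - mu r n) * expR (B * K r).
  have e0 : e @ \oo --> 0.
    rewrite -(mul0r (expR (B * K r))) -(mulr0 B) -(subrr (limn (mu r))).
    apply: cvgMr_tmp; apply: cvgMl_tmp; apply: cvgB => //; exact: cvg_cst.
  have D n : normc (\prod_(i <- s n) f i z - (\prod_(i <- s n) T n i).[z]) <= e n.
    have [_ _] : dominated (@normc R) (\prod_(i <- s n) f i z)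
        (\prod_(i <- s n) (T n i).[z]) (\prod_(i <- s n) (1 + a i * limn (mu r)))
        (\prod_(i <- s n) (1 + a i * mu r n)).
      apply: dominated_prod; rewrite ?normc0 ?normc1 //.
      - exact: normc_ge0.
      - exact: normcD.
      - by move=> x y; rewrite normcM.
      move=> i _; have [f1 fT] := f_near z i n; split.
      - by have [] := normc_dominated1 f1.
      - rewrite -[(T n i).[z]](subrK 1) addrC; apply: le_trans (normcD _ _) _.
        rewrite normc1 lerD2l -[X in _ - X](hornerC 1 z) -hornerN -hornerD.
        by apply: le_trans (normc_horner_le _ _) _; exact: T1.
      - have -> : 1 + a i * limn (mu r) - (1 + a i * mu r n) =
          a i * (limn (mu r) - mu r n) by ring.
        exact: fT.
    rewrite horner_prod => /le_trans; apply.
    apply: le_trans (prod1D_sub_le _ _) _ => [i|].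
      by rewrite mulr_ge0 ?mu_ge0 //= ler_wpM2l.
    apply: ler_pM.
    - by apply: sumr_ge0 => i _; rewrite -mulrBr mulr_ge0 // subr_ge0.
    - by apply: le_trans ler01 _; apply: prod1D_ge1 => i; rewrite mulr_ge0.
    - under eq_bigr do rewrite -mulrBr; rewrite -mulr_suml ler_wpM2r //.
      by rewrite subr_ge0.
    apply: le_trans (prod1D_le_expR _ _) _ => [i|]; first by rewrite mulr_ge0.
    by rewrite ler_expR -mulr_suml; apply: ler_pM => //; exact: sumr_ge0.
  have D0 : (fun n => \prod_(i <- s n) f i z - (\prod_(i <- s n) T n i).[z])
      @ \oo --> (0 : C).
    by apply: cvg_normc_le e0 => n; rewrite sub0r normc_opp.
  have -> : (fun n => \prod_(i <- s n) f i z) =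
      (fun n => (\prod_(i <- s n) f i z - (\prod_(i <- s n) T n i).[z]) +
        (\prod_(i <- s n) T n i).[z]) by apply/funext => n; rewrite subrK.
  by rewrite -[H z]add0r; exact: (cvgD D0 (PH z)).
exists H; split=> // z f0.
apply: (@infinite_prod_neq0 (f^~ z) (fun i => a i * limn (mu (normc z)))
  (B * limn (mu (normc z)))) (fH z) => // [i|n].
  by have [] := f_near z i 0.
rewrite -mulr_suml ler_wpM2r //.
have r0 := normc_ge0 z.
apply: le_trans (mu_ge0 0 r0) _; apply: nondecreasing_cvgn_le; first exact: mu_nd.
by apply: nondecreasing_is_cvgn; [exact: mu_nd|exists (K (normc z)) => _ [k _ <-]; exact: muK].
Unshelve. all: by end_near.
Qed.

End InfiniteProducts.
(** * The lattice *)

Section Lattice.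
Variable R : realType.
Local Notation C := R[i].
Implicit Types (p q : int) (pq mn : int * int) (N : nat).

Local Notation lambda pq := (lattice_pt R pq.1 pq.2).

Lemma lattice_ptE p q :
  lattice_pt R p q = Complex (p%:~R + q%:~R) (q%:~R - p%:~R).
Proof.
have intC (k : int) : (k%:~R : C) = real_complex R k%:~R by rewrite rmorph_int.
rewrite /lattice_pt !intC; apply/eqP; rewrite eq_complex /=.
by apply/andP; split; apply/eqP; ring.
Qed.

Lemma lattice_pt00 : lattice_pt R 0 0 = 0.
Proof. by rewrite /lattice_pt !mul0r addr0. Qed.

Lemma lattice_pt_inj p q p' q' :
  lattice_pt R p q = lattice_pt R p' q' -> (p, q) = (p', q').
Proof.
rewrite !lattice_ptE => -[/eqP]; rewrite -!intrD eqr_int => /eqP h1 /eqP.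
rewrite -!intrB eqr_int => /eqP h2; congr pair; lia.
Qed.

Lemma lattice_pt_eq0 p q : (lattice_pt R p q == 0) = ((p, q) == (0, 0)).
Proof.
apply/eqP/eqP => [|[-> ->]]; last exact: lattice_pt00.
by move=> h; apply: lattice_pt_inj; rewrite h lattice_pt00.
Qed.

Lemma conjc_lattice_pt p q : conjc (lattice_pt R p q) = lattice_pt R q p.
Proof. by rewrite !lattice_ptE /= opprB addrC. Qed.

Lemma normc_lattice_pt_ge p q k : (k <= maxn `|p| `|q|)%N ->
  k%:R <= normc (lattice_pt R p q).
Proof.
rewrite lattice_ptE /= => kpq.
have -> : (p%:~R + q%:~R : R) ^+ 2 + (q%:~R - p%:~R) ^+ 2 =
    2 * (p%:~R ^+ 2 + q%:~R ^+ 2) by ring.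
have sq (x : int) : (x%:~R : R) ^+ 2 = (`|x|%N%:R) ^+ 2.
  by rewrite natr_absz intr_norm real_normK // num_real.
rewrite -[leLHS]ger0_norm ?ler0n // -sqrtr_sqr ler_wsqrtr // !sq.
have x0 : 0 <= (`|p|%N%:R : R) ^+ 2 by exact: sqr_ge0.
have y0 : 0 <= (`|q|%N%:R : R) ^+ 2 by exact: sqr_ge0.
move: kpq; rewrite leq_max => /orP[] kx.
  have : (k%:R : R) ^+ 2 <= `|p|%N%:R ^+ 2 by rewrite lerXn2r ?nnegrE ?ler0n // ler_nat.
  lra.
have : (k%:R : R) ^+ 2 <= `|q|%N%:R ^+ 2 by rewrite lerXn2r ?nnegrE ?ler0n // ler_nat.
lra.
Qed.

Lemma normc_lattice_pt_ge1 p q : (p, q) != (0, 0) ->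
  1 <= normc (lattice_pt R p q).
Proof.
move=> pq0; apply: (@normc_lattice_pt_ge _ _ 1).
by move: pq0; apply: contraNT => h; apply/eqP; congr pair; lia.
Qed.

Definition int_range N : seq int := [seq i%:Z - N%:Z | i <- iota 0 N.*2.+1].

Definition lattice_square N : seq (int * int) :=
  [seq (p, q) | p <- int_range N, q <- int_range N].

Lemma mem_int_range p N : (p \in int_range N) = (`|p| <= N)%N.
Proof.
apply/mapP/idP => [[k] | pN]; first by rewrite mem_iota => + ->; lia.
by exists (absz (p + N%:Z)); rewrite ?mem_iota; lia.
Qed.

Lemma int_range_uniq N : uniq (int_range N).
Proof. by rewrite map_inj_uniq ?iota_uniq // => i j; lia. Qed.

Lemma mem_lattice_square pq N :
  (pq \in lattice_square N) = (maxn `|pq.1| `|pq.2| <= N)%N.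
Proof.
rewrite geq_max -!mem_int_range; case: pq => p q /=.
by apply/allpairsP/andP => [[[p' q'] /= [p'N q'N [-> ->]]]//|[pN qN]];
  exists (p, q).
Qed.

Lemma lattice_square_uniq N : uniq (lattice_square N).
Proof. by apply: allpairs_uniq; rewrite ?int_range_uniq // => -[? ?] [? ?]. Qed.

Lemma lattice_square_sub N M : (N <= M)%N ->
  {subset lattice_square N <= lattice_square M}.
Proof. by move=> NM pq; rewrite !mem_lattice_square => /leq_trans; apply. Qed.

Lemma size_lattice_square N : size (lattice_square N) = (N.*2.+1 ^ 2)%N.
Proof. by rewrite size_allpairs !size_map size_iota mulnn. Qed.

(** The square of radius [N + 1] has [8 (N + 1)] boundary points, all of modulus
    at least [N + 1]; so the boundary contributes at most [8 / (N + 1) ^ 2],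
    which is compared to a telescoping sum. *)
Lemma lattice_sum_bound N :
  \sum_(pq <- lattice_square N) (normc (lambda pq))^-1 ^+ 3 <= 16 :> R.
Proof.
suff : \sum_(pq <- lattice_square N) (normc (lambda pq))^-1 ^+ 3
    <= 16 - 16 / N.+1%:R :> R.
  move/le_trans; apply; rewrite gerBl divr_ge0 //.
elim: N => [|N IH].
  have -> : lattice_square 0 = [:: (0, 0)] by [].
  by rewrite big_seq1 [lattice_pt _ _ _]lattice_pt00 normc0 invr0 expr0n /= divr1 subrr.
have nested (g : int * int -> R) : \sum_(pq <- lattice_square N.+1) g pq =
    \sum_(pq <- lattice_square N) g pq +
    \sum_(pq <- lattice_square N.+1 | pq \notin lattice_square N) g pq.
  rewrite (bigID [in lattice_square N]) /=; congr (_ + _).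
  rewrite (big_nested lattice_square_uniq lattice_square_sub _ _ (leqnSn N)).
  by rewrite -big_mkcond.
have boundary : \sum_(pq <- lattice_square N.+1 | pq \notin lattice_square N) 1
    = 8 * N.+1%:R :> R.
  have := nested (fun=> 1); rewrite !big_const_seq !count_predT !size_lattice_square.
  rewrite !iter_addr_0 => h; apply: (addrI ((N.*2.+1 ^ 2)%:R)).
  rewrite -h -natrM -natrD; congr (_%:R); lia.
rewrite nested; apply: le_trans (lerD IH (_ : _ <= 8 * N.+1%:R * N.+1%:R^-1 ^+ 3)) _.
  rewrite -boundary mulr_suml; apply: ler_sum => pq.
  rewrite mem_lattice_square -ltnNge => Npq; rewrite mul1r.
  by rewrite lerXn2r ?nnegrE ?invr_ge0 ?normc_ge0 ?ler0n // lef_pV2 ?posrE ?ltr0n //;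
    rewrite ?normc_lattice_pt_ge // (lt_le_trans _ (normc_lattice_pt_ge Npq)) ?ltr0n.
have x1 : 1 <= N.+1%:R :> R by rewrite ler1n.
rewrite -[N.+2]addn1 natrD; move: (N.+1%:R) x1 => x x1.
have x0 : 0 < x by lra.
have -> : 16 - 16 / (x + 1) = 16 - 16 / x + 16 / (x * (x + 1)).
  by field; rewrite !gt_eqF ?addr_gt0.
have -> : 8 * x * x^-1 ^+ 3 = 8 / x ^+ 2 by field; rewrite gt_eqF.
rewrite lerD2l ler_pdivrMr ?exprn_gt0 // mulrAC ler_pdivlMr ?mulr_gt0 ?addr_gt0 //.
nra.
Qed.

End Lattice.
(** * The sigma function and its quotients by a linear factor *)

Section SigmaFunction.
Variable R : realType.
Local Notation C := R[i].
Implicit Types (pq mn : int * int) (r : R) (z : C).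
Local Notation lambda pq := (lattice_pt R pq.1 pq.2).

(** * Polynomial approximations of an elementary factor *)

(* Three terms of the exponential are always kept, so that the cancellation of
   the terms of degree 1 and 2 in the factor is exact for every [n]. *)
Let quad : {poly C} := 'X + 2^-1 *: 'X^2.
Let exp_quad n : {poly C} := \sum_(0 <= k < n) (k`!%:R)^-1 *: quad ^+ k.
Let factor_poly n : {poly C} := (1 - 'X) * exp_quad (n + 3)%N.
Let rho r : R := r + r ^+ 2.

Let rho_ge0 r : 0 <= r -> 0 <= rho r.
Proof. by move=> r0; rewrite addr_ge0 ?exprn_ge0. Qed.

Let pnorm_exp_quad_sub r n m : 0 <= r -> (n <= m)%N ->
  pnorm r (exp_quad m - exp_quad n) <=
  series (exp_coeff (rho r)) m - series (exp_coeff (rho r)) n.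
Proof.
move=> r0 nm; rewrite sub_series_geq // /exp_quad (big_cat_nat (leq0n n) nm) //= [X in pnorm _ X]addrAC subrr add0r.
apply: le_trans (pnorm_sum _ _ _ r0) _; apply: ler_sum => k _.
rewrite pnormZ normcV normc_nat mulrC /exp_coeff /= ler_wpM2r ?invr_ge0 ?ler0n //.
apply: le_trans (pnormXn _ _ r0) _; apply: lerXn2r; rewrite ?nnegrE ?pnorm_ge0 ?rho_ge0 //.
apply: le_trans (pnormD _ _ r0) _; rewrite pnormX lerD2l pnormZ normcV normc_nat.
apply: (@le_trans _ _ (pnorm r ('X ^+ 2))).
  by rewrite ler_piMl ?pnorm_ge0 //; lra.
by apply: le_trans (pnormXn _ _ r0) _; rewrite pnormX.
Qed.

Let pnorm_exp_quad r n : 0 <= r ->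
  pnorm r (exp_quad n) <= series (exp_coeff (rho r)) n.
Proof.
move=> r0; have := pnorm_exp_quad_sub r0 (leq0n n).
have -> : exp_quad 0 = 0 by rewrite /exp_quad big_geq.
by rewrite [series _ 0]big_geq // !subr0.
Qed.

Let pnorm_linear r : 0 <= r -> pnorm r (1 - 'X) <= 1 + r.
Proof. by move=> r0; apply: le_trans (pnormD _ _ r0) _; rewrite pnormN pnorm1 pnormX. Qed.

(** The exponent is chosen so that the terms of degree 1 and 2 cancel. *)
Let factor_poly_cubic n : exists p, factor_poly n - 1 = 'X^3 * p.
Proof.
have [p Ep] : exists p, exp_quad (n + 3)%N = 1 + quad + 2^-1 *: quad ^+ 2 + 'X^3 * p.
  exists ((1 + 2^-1 *: 'X) ^+ 3 * \sum_(0 <= k < n) ((k + 3)`!%:R)^-1 *: quad ^+ k).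
  rewrite /exp_quad addnC big_nat_recl // big_nat_recl // big_nat_recl //.
  rewrite !expr0 !expr1 fact0 !invr1 !scale1r !addrA mulrA; congr (_ + _).
  have -> : 'X^3 * (1 + 2^-1 *: 'X) ^+ 3 = quad ^+ 3.
    by rewrite -exprMn /quad mulrDr mulr1 -scalerAr -expr2.
  rewrite mulr_sumr; apply: eq_bigr => k _.
  by rewrite -scalerAr -exprD addn3 add3n.
pose c : {poly C} := (2^-1)%:P.
have c2 : c + c = 1 by rewrite -polyCD -polyC1; congr (_%:P); field.
rewrite /factor_poly Ep /quad -!mul_polyC -/c.
exists ((1 - 'X) * (c + c ^+ 3 * 'X + p) - 1).
set E := _ * (_ + _) - 1.
have -> : E = 'X^3 * ((1 - 'X) * (c + c ^+ 3 * 'X + p) - 1) +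
    (c + c - 1) * (1 - 'X) * ('X^2 + c * 'X^3) by rewrite /E; ring.
by rewrite c2 subrr !mul0r addr0.
Qed.

Let pnorm_factor r n a : 0 <= r -> normc a <= 1 ->
  pnorm r ((factor_poly n \Po (a *: 'X)) - 1) <=
  normc a ^+ 3 * (1 + (1 + r) * series (exp_coeff (rho r)) (n + 3)%N).
Proof.
move=> r0 a1; have -> : (factor_poly n \Po (a *: 'X)) - 1 =
    (factor_poly n - 1) \Po (a *: 'X) by rewrite comp_polyB -polyC1 comp_polyC.
apply: le_trans (pnorm_comp_scale (d := 3) r0 a1 _) _ => [k k3|].
  by have [p ->] := factor_poly_cubic n; rewrite coefXnM k3.
rewrite ler_wpM2l ?exprn_ge0 ?normc_ge0 //.
apply: le_trans (pnormD _ _ r0) _; rewrite pnormN pnorm1 addrC lerD2l.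
apply: le_trans (pnormM _ _ r0) _.
by apply: ler_pM; rewrite ?pnorm_ge0 ?pnorm_linear ?pnorm_exp_quad.
Qed.

Let pnorm_factor_sub r n m a : 0 <= r -> normc a <= 1 -> (n <= m)%N ->
  pnorm r ((factor_poly m \Po (a *: 'X)) - (factor_poly n \Po (a *: 'X))) <=
  normc a ^+ 3 * ((1 + r) * (series (exp_coeff (rho r)) (m + 3)%N -
    series (exp_coeff (rho r)) (n + 3)%N)).
Proof.
move=> r0 a1 nm; rewrite -comp_polyB.
apply: le_trans (pnorm_comp_scale (d := 3) r0 a1 _) _ => [k k3|].
  have [p Ep] := factor_poly_cubic n; have [p' Ep'] := factor_poly_cubic m.
  have -> : factor_poly m - factor_poly n = 'X^3 * (p' - p).
    by rewrite mulrBr -Ep -Ep'; ring.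
  by rewrite coefXnM k3.
rewrite ler_wpM2l ?exprn_ge0 ?normc_ge0 // /factor_poly -mulrBr.
apply: le_trans (pnormM _ _ r0) _.
by apply: ler_pM; rewrite ?pnorm_ge0 ?pnorm_linear ?pnorm_exp_quad_sub ?leq_add2r.
Qed.

Let exp_quad_cvg z : (fun n => (exp_quad (n + 3)%N).[z]) @ \oo -->
  cexp (z + z ^+ 2 / 2%:R).
Proof.
have -> : (fun n => (exp_quad (n + 3)%N).[z]) = [sequence series
    (fun k => (z + z ^+ 2 / 2%:R) ^+ k / k`!%:R) (n + 3)%N]_n.
  apply/funext => n; rewrite /series /exp_quad /= horner_sum.
  apply: eq_bigr => k _.
  by rewrite hornerZ horner_exp /quad hornerD hornerX hornerZ hornerXn mulrC [2^-1 * _]mulrC.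
by rewrite cvg_shiftn; exact: cexp_cvg.
Qed.

(** * The factors of the quotient *)

(** The factors of [sigma z / (z - lambda mn)], where the factor that vanishes
    at [lambda mn] has been divided by [z - lambda mn]. *)
Definition sigma_div_factor mn pq z : C :=
  if pq == mn then
    if pq == (0, 0) then 1
    else let u := z / lambda pq in - (lambda pq)^-1 * cexp (u + u ^+ 2 / 2%:R)
  else if pq == (0, 0) then z else weierstrass_factor (z / lambda pq).

Let approx mn n pq : {poly C} :=
  let a := (lambda pq)^-1 in
  if pq == mn then
    if pq == (0, 0) then 1 else - a *: (exp_quad (n + 3)%N \Po (a *: 'X))
  else if pq == (0, 0) then 'X else factor_poly n \Po (a *: 'X).

Let weight mn pq : R :=
  (normc (lambda pq))^-1 ^+ 3 + (pq == (0, 0))%:R + (pq == mn)%:R.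

Let mu r n : R := 1 + (1 + r) * series (exp_coeff (rho r)) (n + 3)%N.

Let normc_lambda_inv pq : normc (lambda pq)^-1 <= 1.
Proof.
have [pq0|pq0] := boolP (pq == (0, 0)).
  by rewrite (eqP pq0) [lattice_pt _ _ _]lattice_pt00 invr0 normc0 ler01.
rewrite normcV invf_le1 //; last apply: (lt_le_trans ltr01);
  by apply: normc_lattice_pt_ge1; case: pq pq0.
Qed.

Let S_ge1 r n : 0 <= r -> 1 <= series (exp_coeff (rho r)) (n + 3)%N.
Proof.
move=> r0; rewrite addnC /series /= big_nat_recl // /exp_coeff /= expr0 divr1.
rewrite lerDl; apply: sumr_ge0 => k _.
by rewrite divr_ge0 ?ler0n ?exprn_ge0 ?rho_ge0.
Qed.

Let S_nd r n m : 0 <= r -> (n <= m)%N ->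
  series (exp_coeff (rho r)) (n + 3)%N <= series (exp_coeff (rho r)) (m + 3)%N.
Proof.
move=> r0 nm; apply: nondecreasing_series; last by rewrite leq_add2r.
by move=> k _ _; exact/exp_coeff_ge0/rho_ge0.
Qed.

Let weight_ge0 mn pq : 0 <= weight mn pq.
Proof. by rewrite !addr_ge0 // exprn_ge0 // invr_ge0 normc_ge0. Qed.

Let weight_sum mn N : \sum_(pq <- lattice_square N) weight mn pq <= 18.
Proof.
have one_le (x : int * int) : \sum_(pq <- lattice_square N) (pq == x)%:R <= 1 :> R.
  rewrite (eq_bigr (fun pq => if pq == x then 1 else 0)); last first.
    by move=> pq _; case: ifP.
  rewrite -big_mkcond -[X in X <= _]/(\sum_(pq <- _ | pq == x) 1%:R) -natr_sum.
  by rewrite sum1_count count_uniq_mem ?lattice_square_uniq // lern1 leq_b1.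
rewrite !big_split /=.
have -> : 18 = 16 + 1 + 1 :> R by ring.
by rewrite !lerD // lattice_sum_bound.
Qed.

Let weight_ge1 mn pq : pq == (0, 0) \/ pq == mn -> 1 <= weight mn pq.
Proof.
have w0 : 0 <= (normc (lambda pq))^-1 ^+ 3 by rewrite exprn_ge0 // invr_ge0 normc_ge0.
rewrite /weight => -[] ->.
  by have := ler0n R (pq == mn); rewrite mulr1n; lra.
by have := ler0n R (pq == (0, 0)); rewrite mulr1n; lra.
Qed.

Let weight_ge mn pq : normc (lambda pq)^-1 ^+ 3 <= weight mn pq.
Proof. by rewrite normcV /weight -addrA lerDl addr_ge0. Qed.

Let mu_ge1 r n : 0 <= r -> 1 + r <= mu r n.
Proof. by move=> r0; have := S_ge1 n r0; rewrite /mu; nra. Qed.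

Let approx1 mn r n pq : 0 <= r ->
  pnorm r (approx mn n pq - 1) <= weight mn pq * mu r n.
Proof.
move=> r0; have mu1 := mu_ge1 n r0; have mu0 : 0 <= mu r n by lra.
have trivial_case p : pq == (0, 0) \/ pq == mn -> p <= mu r n -> p <= weight mn pq * mu r n.
  by move=> /weight_ge1 w1 /le_trans; apply; rewrite ler_peMl.
rewrite /approx; case: ifP => pqmn; case: ifP => pq0.
- by rewrite subrr pnorm0 mulr_ge0 // weight_ge0.
- apply: trivial_case; first by right.
  apply: le_trans (pnormD _ _ r0) _; rewrite pnormN pnorm1 addrC /mu lerD2l pnormZ normc_opp.
  apply: (@le_trans _ _ (1 * series (exp_coeff (rho r)) (n + 3)%N)).
    apply: ler_pM; rewrite ?normc_ge0 ?pnorm_ge0 //.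
    apply: le_trans (pnorm_comp_scale (d := 0) r0 (normc_lambda_inv pq) _) _ => //.
    by rewrite mul1r pnorm_exp_quad.
  by rewrite ler_wpM2r ?lerDl // (le_trans ler01) // S_ge1.
- apply: trivial_case; first by left.
  by apply: le_trans (pnormD _ _ r0) _; rewrite pnormN pnorm1 pnormX addrC.
apply: le_trans (pnorm_factor n r0 (normc_lambda_inv pq)) _.
by rewrite ler_wpM2r // weight_ge.
Qed.

Let approx_cauchy mn r n m pq : 0 <= r -> (n <= m)%N ->
  pnorm r (approx mn m pq - approx mn n pq) <= weight mn pq * (mu r m - mu r n).
Proof.
move=> r0 nm; have -> : mu r m - mu r n = (1 + r) *
    (series (exp_coeff (rho r)) (m + 3)%N - series (exp_coeff (rho r)) (n + 3)%N).
  by rewrite /mu; ring.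
have S0 := S_nd r0 nm; rewrite -subr_ge0 in S0.
have rS0 : 0 <= (1 + r) * (series (exp_coeff (rho r)) (m + 3)%N -
  series (exp_coeff (rho r)) (n + 3)%N) by rewrite mulr_ge0 // addr_ge0.
rewrite /approx; case: ifP => pqmn; case: ifP => pq0.
- by rewrite subrr pnorm0 mulr_ge0 // weight_ge0.
- rewrite -scalerBr -comp_polyB pnormZ normc_opp.
  apply: ler_pM; rewrite ?normc_ge0 ?pnorm_ge0 //.
    by apply: le_trans (normc_lambda_inv _) (weight_ge1 _); right.
  apply: le_trans (pnorm_comp_scale (d := 0) r0 (normc_lambda_inv pq) _) _ => //.
  rewrite mul1r; apply: le_trans (pnorm_exp_quad_sub r0 _) _; first by rewrite leq_add2r.
  by rewrite ler_peMl // lerDl.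
- by rewrite subrr pnorm0 mulr_ge0 // weight_ge0.
apply: le_trans (pnorm_factor_sub r0 (normc_lambda_inv pq) nm) _.
by rewrite ler_wpM2r // weight_ge.
Qed.

Let approx_cvg mn pq z :
  (fun n => (approx mn n pq).[z]) @ \oo --> sigma_div_factor mn pq z.
Proof.
rewrite /approx /sigma_div_factor; case: ifP => _; case: ifP => _.
- by under eq_fun do rewrite hornerC; exact: (cvg_cst (1 : C)).
- set a := (lambda pq)^-1.
  have -> : (fun n => (- a *: (exp_quad (n + 3)%N \Po (a *: 'X))).[z]) =
      (fun n => - a * (exp_quad (n + 3)%N).[z / lambda pq]).
    by apply/funext => n; rewrite hornerZ horner_comp hornerZ hornerX [a * z]mulrC.
  exact: cvgcMl (@exp_quad_cvg (z / lambda pq)).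
- by under eq_fun do rewrite hornerX; exact: (cvg_cst (z : C)).
set u := z / lambda pq.
have -> : (fun n => (factor_poly n \Po ((lambda pq)^-1 *: 'X)).[z]) =
    (fun n => (1 - u) * (exp_quad (n + 3)%N).[u]).
  apply/funext => n; rewrite horner_comp hornerZ hornerX [_ * z]mulrC -/u.
  by rewrite hornerM !hornerE.
exact: cvgcMl (@exp_quad_cvg u).
Qed.

(** Apart from the factors of index [(0, 0)] and [mn], the distance of a factor
    to [1] is of order [normc (lambda pq) ^- 3], by the cubic vanishing, and these
    numbers are summable over the lattice. *)
Lemma sigma_div_factor_prod mn : exists H : C -> C,
  [/\ exists c, expansion H c,
      forall z, (fun N => \prod_(pq <- lattice_square N) sigma_div_factor mn pq z)
        @ \oo --> H z &
      forall z, (forall pq, sigma_div_factor mn pq z != 0) -> H z != 0].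
Proof.
apply: (@weierstrass_product R _ lattice_square lattice_square_uniq
  lattice_square_sub (weight mn) 18 (approx mn) mu
  (fun r => 1 + (1 + r) * expR (rho r))).
- exact: weight_ge0.
- exact: weight_sum.
- by move=> r n r0; have := mu_ge1 n r0; lra.
- move=> r r0 n m nm; rewrite /mu lerD2l ler_wpM2l ?addr_ge0 //.
  exact: S_nd.
- move=> r n r0; rewrite /mu lerD2l ler_wpM2l ?addr_ge0 //.
  exact/series_exp_le/rho_ge0.
- by move=> r n pq; exact: approx1.
- by move=> r n m pq; exact: approx_cauchy.
- by move=> pq z; exact: approx_cvg.
Qed.

Lemma sigma_div_factor_neq0 mn pq z :
  (forall p q, z = lattice_pt R p q -> (p, q) = mn) ->
  sigma_div_factor mn pq z != 0.
Proof.
move=> zmn; rewrite /sigma_div_factor; case: ifP => pqmn; case: ifP => pq0.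
- exact: oner_neq0.
- by rewrite mulf_neq0 ?cexp_neq0 // oppr_eq0 invr_eq0 lattice_pt_eq0 -surjective_pairing pq0.
- apply: contraFN pqmn => /eqP z0; rewrite (eqP pq0); apply/eqP/zmn.
  by rewrite z0 lattice_pt00.
rewrite mulf_neq0 ?cexp_neq0 // subr_eq0; apply: contraFN pqmn => /eqP zl.
have l0 : lambda pq != 0 by rewrite lattice_pt_eq0 -surjective_pairing pq0.
apply/eqP; rewrite [pq]surjective_pairing; apply: zmn.
by rewrite -[LHS](divfK l0) -zl mul1r.
Qed.

Let full_factor pq z : C :=
  if pq == (0, 0) then z else weierstrass_factor (z / lambda pq).

Let full_factorE mn z N : mn \in lattice_square N ->
  \prod_(pq <- lattice_square N) full_factor pq z =
  (z - lambda mn) * \prod_(pq <- lattice_square N) sigma_div_factor mn pq z.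
Proof.
move=> mnN; rewrite !(bigD1_seq mn mnN (lattice_square_uniq N)) mulrA.
congr (_ * _); last first.
  by apply: eq_bigr => pq /negPf pqmn; rewrite /sigma_div_factor pqmn.
rewrite /full_factor /sigma_div_factor eqxx; case: ifP => mn0.
  by rewrite (eqP mn0) [lattice_pt _ _ _]lattice_pt00 subr0 mulr1.
have l0 : lambda mn != 0 by rewrite lattice_pt_eq0 -surjective_pairing mn0.
by rewrite /weierstrass_factor mulrA; congr (_ * _); field.
Qed.

Let sigma_partialE z N :
  sigma_partial z N = \prod_(pq <- lattice_square N) sigma_div_factor (0, 0) pq z.
Proof.
rewrite /lattice_square big_allpairs /int_range big_map /sigma_partial.
rewrite -[iota _ _]/(index_iota 0 N.*2.+1) big_mkord; apply: eq_bigr => j _.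
rewrite big_map big_mkord big_mkcond.
by apply: eq_bigr => k _; rewrite /sigma_div_factor; case: eqP.
Qed.

(** The infinite product without its factor vanishing at [lambda mn] gives the
    quotient as an entire function, with no zero at [lambda mn]: the zeros of
    [sigma] are simple. *)
Lemma sigma_quotient mn : exists H : C -> C,
  [/\ exists c, expansion H c,
      forall z, sigma z = (z - lambda mn) * H z &
      forall z, (forall p q, z = lattice_pt R p q -> (p, q) = mn) -> H z != 0].
Proof.
have [H0 [_ H0z _]] := sigma_div_factor_prod (0, 0).
have [H [Hc Hz Hn0]] := sigma_div_factor_prod mn.
exists H; split=> // z; last first.
  by move=> zmn; apply: Hn0 => pq; exact: sigma_div_factor_neq0.
have -> : sigma z = z * H0 z.
  rewrite /sigma (_ : sigma_partial z = fun N =>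
    \prod_(pq <- lattice_square N) sigma_div_factor (0, 0) pq z); last first.
    by apply/funext => N; exact: sigma_partialE.
  by rewrite (cvg_lim (@norm_hausdorff _ C) (H0z z)).
apply: (@cvgc_unique R (fun N => z * \prod_(pq <- lattice_square N)
  sigma_div_factor (0, 0) pq z)); first exact: cvgcMl.
have := cvgcMl (w := z - lambda mn) (Hz z).
apply: cvg_trans; apply: near_eq_cvg; near=> N.
rewrite -full_factorE; last first.
  by rewrite mem_lattice_square; near: N; exact: nbhs_infty_ge.
rewrite (full_factorE (mn := (0, 0))) ?mem_lattice_square //.
by rewrite [lattice_pt _ _ _]lattice_pt00 subr0.
Unshelve. all: by end_near.
Qed.

End SigmaFunction.
(** * Everywhere convergent power series *)

Section PowerSeries.
Variable R : realType.
Local Notation C := R[i].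
Implicit Types (f : C -> C) (c d e : nat -> C) (r : R) (z w : C).

(** Comparison with a geometric series, the terms of the power series being
    bounded at the point [2 * r]. *)
Lemma expansion_abs_bound f c r : expansion f c -> 0 <= r ->
  exists B, forall n, \sum_(0 <= k < n) normc (c k) * r ^+ k <= B.
Proof.
move=> fc r0; pose z : C := real_complex R (2 * r).
have zr : normc z = 2 * r by rewrite normc_real // mulr_ge0.
have /normc_cvg c0 : (fun k => c k * z ^+ k) @ \oo --> (0 : C).
  by apply: cvg_series_cvg_0; apply/cvg_ex; exists (f z); exact: fc.
have [M cM] : exists M, forall k, normc (c k * z ^+ k) <= M.
  have /cvg_seq_bounded : cvgn (fun k => normc (c k * z ^+ k)).
    by apply/cvg_ex; eexists; exact: c0.
  move=> /pinfty_ex_gt0[M _ /= hM]; exists M => k.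
  by apply: le_trans (ler_norm _) _; exact: hM.
exists (2 * M) => n.
suff : \sum_(0 <= k < n) normc (c k) * r ^+ k <= 2 * M - 2 * M / 2 ^+ n.
  move/le_trans; apply; rewrite gerBl divr_ge0 ?exprn_ge0 // mulr_ge0 //.
  exact: le_trans (normc_ge0 _) (cM 0%N).
elim: n => [|n IH]; first by rewrite big_geq // expr0 divr1 subrr.
rewrite big_nat_recr //=; apply: le_trans (lerD IH (_ : _ <= M / 2 ^+ n)) _.
  by rewrite ler_pdivlMr ?exprn_gt0 // -mulrA -exprMn [r * 2]mulrC -zr -normcX -normcM.
have p0 : 0 < 2 ^+ n :> R by rewrite exprn_gt0.
rewrite exprS le_eqVlt; apply/orP; left; apply/eqP; field.
by rewrite gt_eqF.
Qed.

Lemma normc_subX_le r w z k : 1 <= r -> normc w <= r -> normc z <= r ->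
  normc (w ^+ k - z ^+ k) <= normc (w - z) * (2 * r) ^+ k.
Proof.
move=> r1 wr zr; have r0 : 0 <= r by exact: le_trans r1.
elim: k => [|k IH]; first by rewrite !expr0 subrr normc0 mulr1 normc_ge0.
have -> : w ^+ k.+1 - z ^+ k.+1 = w * (w ^+ k - z ^+ k) + (w - z) * z ^+ k.
  by rewrite !exprS; ring.
apply: le_trans (normcD _ _) _; rewrite !normcM normcX.
have h1 : normc w * normc (w ^+ k - z ^+ k) <= r * (normc (w - z) * (2 * r) ^+ k).
  by apply: ler_pM; rewrite ?normc_ge0.
have h2 : normc (w - z) * normc z ^+ k <= normc (w - z) * (2 * r) ^+ k.
  rewrite ler_wpM2l ?normc_ge0 // lerXn2r ?nnegrE ?normc_ge0 ?mulr_ge0 //.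
  by apply: le_trans zr _; lra.
apply: le_trans (lerD h1 h2) _; rewrite exprS.
have X0 : 0 <= normc (w - z) * (2 * r) ^+ k.
  by rewrite mulr_ge0 ?normc_ge0 ?exprn_ge0 // mulr_ge0.
move: (normc (w - z)) ((2 * r) ^+ k) X0 => x y xy; nra.
Qed.

(** Continuity in a form that passes to the limit from the partial sums. *)
Lemma expansion_lipschitz f c r : expansion f c -> 1 <= r ->
  exists L, forall w z, normc w <= r -> normc z <= r ->
    normc (f w - f z) <= normc (w - z) * L.
Proof.
move=> fc r1; have r0 : 0 <= r by exact: le_trans r1.
have [|L cL] := @expansion_abs_bound f c (2 * r) fc; first by rewrite mulr_ge0.
exists L => w z wr zr.
have lim1 : (fun n => normc (series (fun k => c k * w ^+ k) n -
    series (fun k => c k * z ^+ k) n)) @ \oo --> normc (f w - f z).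
  by apply: normc_cvg; exact: (cvgB (fc w) (fc z)).
apply: (cvgr_to_le lim1); near=> n; rewrite /series /= -sumrB.
apply: le_trans (normc_sum _ _ _) _; apply: (@le_trans _ _ (\sum_(0 <= k < n)
    normc (w - z) * (normc (c k) * (2 * r) ^+ k))).
  apply: ler_sum => k _; rewrite -mulrBr normcM mulrCA ler_wpM2l ?normc_ge0 //.
  exact: normc_subX_le.
by rewrite -mulr_sumr ler_wpM2l ?normc_ge0.
Unshelve. all: by end_near.
Qed.

Lemma expansion_continuous f c z : expansion f c -> f w @[w --> z^'] --> f z.
Proof.
move=> fc; pose r := normc z + 1.
have [|L fL] := @expansion_lipschitz f c r fc; first by rewrite lerDr normc_ge0.
apply/cvgrPdist_lt => -[e e'] /=; rewrite ltcE /= => /andP[/eqP -> e0].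
pose L' := `|L| + 1; have L'0 : 0 < L' by rewrite ltr_wpDl.
have d0 : 0 < Num.min 1 (e / L') by rewrite lt_min ltr01 divr_gt0.
exists (real_complex R (Num.min 1 (e / L'))); first by rewrite /= (ltcR 0).
move=> w /= + _; rewrite !normc_abs ltcR lt_min ltr_pdivlMr // => /andP[zw1 zwe].
rewrite ltcR; apply: le_lt_trans zwe.
have wr : normc w <= r.
  rewrite -[w](subrK z) addrC; apply: le_trans (normcD _ _) _.
  by rewrite lerD2l normc_distC ltW.
apply: le_trans (fL _ _ _ wr) _; first by rewrite lerDl.
rewrite ler_wpM2l ?normc_ge0 //; apply: le_trans (ler_norm L) _.
by rewrite lerDl.
Qed.

(** After division by [z ^+ k], the series whose first [k] coefficients vanish
    is the expansion of a function that vanishes outside [0] and takes the value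
    [e k] at [0]; so [e k = 0] by continuity. *)
Lemma expansion0 e : expansion (fun=> 0) e -> forall k, e k = 0.
Proof.
move=> e0 k; elim/ltn_ind: k => k IH.
pose g z := if z == 0 then e k else 0.
have gE : expansion g (fun j => e (k + j)%N).
  move=> z; rewrite /g; case: eqP => [->|/eqP z0].
    rewrite -cvg_shiftS (_ : [sequence _]_n = fun=> e k).
      exact: (cvg_cst (e k : C)).
    apply/funext => n; rewrite /series /= big_nat_recl // addn0 expr0 mulr1.
    by rewrite big1 ?addr0 // => j _; rewrite exprS mul0r mulr0.
  have -> : series (fun j => e (k + j)%N * z ^+ j) =
      (fun n => z ^- k * series (fun j => e j * z ^+ j) (n + k)%N).
    apply/funext => n; rewrite /series /= (big_cat_nat (leq0n k) (leq_addl n k)).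
    rewrite /= [X in _ * (X + _)]big1_seq; last first.
      by move=> j /andP[_]; rewrite mem_index_iota => /IH ->; rewrite mul0r.
    rewrite add0r -[X in _ * \sum_(X <= _ < _) _]add0n big_addn addnK mulr_sumr.
    apply: eq_bigr => j _; rewrite exprD addnC; field.
    by rewrite expf_neq0.
  rewrite -(mulr0 (z ^- k)); apply: cvgcMl.
  by have := e0 z; rewrite -(cvg_shiftn k).
have [L gL] := expansion_lipschitz gE (lexx 1).
pose x := normc (e k); pose L' := x + `|L|.
have x0 : 0 <= x by exact: normc_ge0.
apply: eq0_normc; apply/eqP; rewrite -/x eq_le x0 andbT leNgt; apply/negP => xgt0.
have L'0 : 0 < L' by rewrite ltr_pwDl.
pose t := x / (2 * L').
have t0 : 0 < t by rewrite divr_gt0 // mulr_gt0.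
have t1 : t <= 1.
  rewrite ler_pdivrMr ?mulr_gt0 // mul1r /L'; have := normr_ge0 L; lra.
have nt : normc (real_complex R t) = t by rewrite normc_real // ltW.
have := gL (real_complex R t) 0; rewrite nt normc0 subr0 nt => /(_ t1 ler01).
rewrite /g eqxx (negPf (_ : real_complex R t != 0)); last first.
  by rewrite -(rmorph0 (real_complex R)) (inj_eq (@complexI R)) gt_eqF.
rewrite sub0r normc_opp -/x => xtL.
have : x <= t * L' by apply: le_trans xtL _; rewrite ler_wpM2l ?(ltW t0) // (le_trans (ler_norm _)) // lerDr.
have -> : t * L' = x / 2 by rewrite /t; field; rewrite gt_eqF.
lra.
Qed.

Lemma expansion_unique f c d : expansion f c -> expansion f d -> c = d.
Proof.
move=> fc fd; apply/funext => k; apply/eqP; rewrite -subr_eq0; apply/eqP.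
apply: (expansion0 (e := fun k => c k - d k)) => z; rewrite -(subrr (f z)).
have -> : series (fun k => (c k - d k) * z ^+ k) = (fun n =>
    series (fun k => c k * z ^+ k) n - series (fun k => d k * z ^+ k) n).
  by apply/funext => n; rewrite /series /= -sumrB; apply: eq_bigr => j _; rewrite mulrBl.
exact: (cvgB (fc z) (fd z)).
Qed.

Definition mul_linear_coef (a : C) d k : C :=
  (if k is j.+1 then d j else 0) - a * d k.

Lemma expansion_mul_linear (a : C) f d : expansion f d ->
  expansion (fun z => (z - a) * f z) (mul_linear_coef a d).
Proof.
move=> fd z; rewrite -cvg_shiftS.
have -> : [sequence series (fun k => mul_linear_coef a d k * z ^+ k) n.+1]_n =
    (fun n => z * series (fun k => d k * z ^+ k) n -
      a * series (fun k => d k * z ^+ k) n.+1).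
  apply/funext => n; rewrite /series /= !mulr_sumr.
  under eq_bigr do rewrite mulrBl.
  rewrite sumrB big_nat_recl // mul0r add0r; congr (_ - _).
    by apply: eq_bigr => j _; rewrite exprS mulrCA.
  by apply: eq_bigr => j _; rewrite mulrA.
rewrite mulrBl; have fd1 := fd z; rewrite -cvg_shiftS in fd1.
exact: (cvgB (cvgcMl (fd z)) (cvgcMl fd1)).
Qed.

End PowerSeries.
(** * The entire functions [sigma_div] *)

Section SigmaDiv.
Variable R : realType.
Local Notation C := R[i].

Lemma power_series_coefP (f : C -> C) : (exists c, expansion f c) ->
  expansion f (power_series_coef f).
Proof. by move=> fc; exact: (getPex fc). Qed.

(** The quotient built as an infinite product is continuous, hence it is also the
    function whose value at the removable singularity is defined as a limit. *)
Lemma sigma_divP m n :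
  [/\ exists c, expansion (sigma_div (R := R) m n) c,
      forall z, sigma z = (z - lattice_pt R m n) * sigma_div m n z &
      forall z, (forall p q, z = lattice_pt R p q -> (p, q) = (m, n)) ->
        sigma_div m n z != 0].
Proof.
have [H [[c Hc] sH H0]] := sigma_quotient R (m, n).
suff -> : sigma_div m n = H by split=> //; exists c.
apply/funext => z; rewrite /sigma_div.
have fH w : w != lattice_pt R m n -> sigma w / (w - lattice_pt R m n) = H w.
  by move=> wl; rewrite sH [X in X / _]mulrC mulfK // subr_eq0.
case: eqP => [->|/eqP zl]; last exact: fH.
apply: cvg_lim; first exact: norm_hausdorff.
have := expansion_continuous (z := lattice_pt R m n) Hc.
apply: cvg_trans; apply: near_eq_cvg; near=> w.
by rewrite fH //; near: w; exact: nbhs_dnbhs_neq.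
Unshelve. all: by end_near.
Qed.

End SigmaDiv.

(** * Entire functions of an endomorphism *)

Section EntireFunctionalCalculus.
Variables (R : realType) (V : vectType R[i]).
Local Notation C := R[i].
Implicit Types (A B : 'End(V)) (x y : V) (u v : nat -> V).
Let e := vbasis {:V}.
Let e_basis : basis_of {:V} e := vbasisP {:V}.

(** The topology of a finite dimensional space, through coordinates. *)
Definition cvgv u x := forall i, (fun n => coord e i (u n)) @ \oo --> coord e i x.

Lemma cvgv_unique u x y : cvgv u x -> cvgv u y -> x = y.
Proof.
move=> ux uy; rewrite (coord_basis e_basis (memvf x)) (coord_basis e_basis (memvf y)).
by apply: eq_bigr => i _; rewrite (cvgc_unique (ux i) (uy i)).
Qed.

Lemma cvgvB u v x y : cvgv u x -> cvgv v y -> cvgv (fun n => u n - v n) (x - y).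
Proof.
move=> ux vy i; rewrite linearB.
have -> : (fun n => coord e i (u n - v n)) =
    (fun n => coord e i (u n) - coord e i (v n)) by apply/funext => n; rewrite linearB.
exact: (cvgB (ux i) (vy i)).
Qed.

Lemma cvgvZ (a : nat -> C) (l : C) x : a @ \oo --> l -> cvgv (fun n => a n *: x) (l *: x).
Proof.
move=> al i; rewrite linearZ.
have -> : (fun n => coord e i (a n *: x)) = (fun n => coord e i x * a n).
  by apply/funext => n; rewrite linearZ /= mulrC.
by rewrite /= [X in _ --> X]mulrC; exact: cvgcMl.
Qed.

Lemma cvgv_scale (a : C) u x : cvgv u x -> cvgv (fun n => a *: u n) (a *: x).
Proof.
move=> ux i; rewrite linearZ.
have -> : (fun n => coord e i (a *: u n)) = (fun n => a * coord e i (u n)).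
  by apply/funext => n; rewrite linearZ.
exact: cvgcMl.
Qed.

Lemma cvgvS u x : cvgv u x -> cvgv (fun n => u n.+1) x.
Proof. by move=> ux i; have := ux i; rewrite -cvg_shiftS. Qed.

Lemma cvg_mx_entries m n (M : nat -> 'M[C]_(m, n)) (L : 'M[C]_(m, n)) :
  (forall i j, (fun k => M k i j) @ \oo --> L i j) -> M @ \oo --> L.
Proof.
move=> ML P [Q LQ QP].
have : \forall k \near \oo, forall i j, Q i j (M k i j).
  apply: filter_forall => i; apply: filter_forall => j.
  exact: ML (LQ i j).
by apply: filterS => k; exact: QP.
Qed.

Let P A k : 'M[C]_(\dim {:V}) := passmx.mxof e e (lfun_pow A k).

Let P0 A : P A 0 = 1%:M.
Proof. by rewrite /P /= passmx.mxof1 // (basis_free e_basis). Qed.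

Let PS A k : P A k.+1 = P A k *m P A 1.
Proof. by rewrite /P /= -!passmx.mxof_comp // comp_lfun1r. Qed.

Let P_bound A k i j :
  normc (P A k i j) <= (\sum_a \sum_b normc (P A 1 a b)) ^+ k.
Proof.
set K := \sum_a _.
have K0 : 0 <= K by do 2 apply: sumr_ge0 => ? _; exact: normc_ge0.
elim: k i j => [|k IH] i j.
  rewrite P0 mxE expr0; case: eqP => _; first by rewrite normc1.
  by rewrite normc0.
rewrite PS mxE exprSr; apply: le_trans (normc_sum _ _ _) _.
apply: (@le_trans _ _ (\sum_l K ^+ k * normc (P A 1 l j))).
  by apply: ler_sum => l _; rewrite normcM ler_wpM2r ?normc_ge0.
rewrite -mulr_sumr ler_wpM2l ?exprn_ge0 //; apply: ler_sum => a _.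
by rewrite (bigD1 j) //= lerDl; apply: sumr_ge0 => ? _; exact: normc_ge0.
Qed.

Let mx_series_cvg (f : C -> C) c A : expansion f c ->
  exists L : 'M[C]_(\dim {:V}),
    (series (fun k => c k *: P A k) : nat -> 'M[C]_(\dim {:V})) @ \oo --> L /\
    forall i j, (fun n => \sum_(0 <= k < n) c k * P A k i j) @ \oo --> L i j.
Proof.
move=> fc; set K := \sum_a \sum_b normc (P A 1 a b).
have K0 : 0 <= K by do 2 apply: sumr_ge0 => ? _; exact: normc_ge0.
have [B cB] := expansion_abs_bound fc K0.
have entry i j : exists l : C, (fun n => \sum_(0 <= k < n) c k * P A k i j) @ \oo --> l.
  have [n|n m nm|l] := @cauchy_majorant R
    (fun n => \sum_(0 <= k < n) normc (c k) * K ^+ k) B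
    (fun n => \sum_(0 <= k < n) c k * P A k i j).
  - exact: cB.
  - rewrite !(big_cat_nat (leq0n n) nm) /= ![_ + _ - _]addrAC !subrr !add0r.
    apply: le_trans (normc_sum _ _ _) _; apply: ler_sum => k _.
    by rewrite normcM ler_wpM2l ?normc_ge0.
  - by exists l.
pose L : 'M[C]_(\dim {:V}) := \matrix_(i, j) xget 0 [set l : C |
  (fun n => \sum_(0 <= k < n) c k * P A k i j) @ \oo --> l].
have PL i j : (fun n => \sum_(0 <= k < n) c k * P A k i j) @ \oo --> L i j.
  rewrite mxE; have [l hl] := entry i j.
  exact: (@xgetPex C 0 [set l : C | _ @ \oo --> l] (ex_intro _ l hl)).
exists L; split=> //; apply: cvg_mx_entries => i j.
have -> : (fun n => series (fun k => c k *: P A k) n i j) =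
    (fun n => \sum_(0 <= k < n) c k * P A k i j).
  by apply/funext => n; rewrite /series /= summxE; apply: eq_bigr => k _; rewrite mxE.
exact: PL.
Qed.

(** The entries of the [k]-th power of a matrix are at most [K ^ k], with [K] the
    sum of the moduli of its entries, and the power series converges absolutely
    at [K]. *)
Lemma entire_lfun_cvg (f : C -> C) A x : (exists c, expansion f c) ->
  cvgv (fun n => \sum_(0 <= k < n) power_series_coef f k *: lfun_pow A k x)
    (entire_lfun f A x).
Proof.
move=> /power_series_coefP fc; set c := power_series_coef f in fc *.
have [L [PL PLe]] := mx_series_cvg A fc.
have -> : entire_lfun f A = passmx.hommx e e L.
  by rewrite /entire_lfun (cvg_lim (@norm_hausdorff _ _) PL).
move=> i.
have entry M : coord e i (passmx.hommx e e M x) =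
    \sum_j passmx.rVof e x 0 j * M j i.
  by rewrite passmx.hommxE // passmx.coord_vecof // mxE.
rewrite entry.
have -> : (fun n => coord e i (\sum_(0 <= k < n) c k *: lfun_pow A k x)) =
    (fun n => \sum_j passmx.rVof e x 0 j * \sum_(0 <= k < n) c k * P A k j i).
  apply/funext => n; rewrite linear_sum /=.
  under [RHS]eq_bigr do rewrite mulr_sumr; rewrite exchange_big /=.
  apply: eq_bigr => k _; rewrite linearZ /= -[lfun_pow A k](passmx.mxofK e_basis e_basis) entry.
  by rewrite mulr_sumr; apply: eq_bigr => j _; rewrite mulrCA.
by apply: cvg_sum_seq => j; apply: cvgcMl.
Qed.

Lemma lfun_powS A k x : lfun_pow A k.+1 x = A (lfun_pow A k x).
Proof. by rewrite /= comp_lfunE. Qed.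

Lemma lfun_powSr A k x : lfun_pow A k.+1 x = lfun_pow A k (A x).
Proof.
elim: k => [|k IH]; first by rewrite lfun_powS /= !id_lfunE.
by rewrite lfun_powS IH lfun_powS.
Qed.

Lemma entire_lfun_eigen (f : C -> C) A (a : C) x : (exists c, expansion f c) ->
  A x = a *: x -> entire_lfun f A x = f a *: x.
Proof.
move=> fc Ax; apply: cvgv_unique (@entire_lfun_cvg _ A x fc) _.
have pow k : lfun_pow A k x = a ^+ k *: x.
  elim: k => [|k IH]; first by rewrite /= id_lfunE expr0 scale1r.
  by rewrite lfun_powS IH linearZ /= Ax scalerA exprSr.
rewrite (_ : (fun n => _) = fun n =>
  series (fun k => power_series_coef f k * a ^+ k) n *: x).
  by apply: cvgvZ; exact: power_series_coefP.
apply/funext => n; rewrite /series /= scaler_suml.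
by apply: eq_bigr => k _; rewrite pow scalerA.
Qed.

(** Multiplication of a power series by [z - a] and right composition with
    [A - a] have the same effect on the truncated sums. *)
Lemma entire_lfun_mul_linear (f g : C -> C) (a : C) A x :
  (exists c, expansion g c) -> (forall z, f z = (z - a) * g z) ->
  entire_lfun f A x = entire_lfun g A (A x - a *: x).
Proof.
move=> gc fg; have gd := power_series_coefP gc; set d := power_series_coef g in gd.
have fd : expansion f (mul_linear_coef a d).
  by rewrite (_ : f = fun z => (z - a) * g z);
    [exact: expansion_mul_linear | exact/funext].
have fc : exists c, expansion f c by eexists; exact: fd.
have fE : power_series_coef f = mul_linear_coef a d.
  exact: expansion_unique (power_series_coefP fc) fd.
apply: cvgv_unique (cvgvS (@entire_lfun_cvg _ A x fc)) _; rewrite fE.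
have -> : (fun n => \sum_(0 <= k < n.+1) mul_linear_coef a d k *: lfun_pow A k x) =
    (fun n => \sum_(0 <= k < n) d k *: lfun_pow A k (A x) -
       a *: (\sum_(0 <= k < n.+1) d k *: lfun_pow A k x)).
  apply/funext => n; under eq_bigr do rewrite scalerBl.
  rewrite sumrB big_nat_recl // scale0r add0r scaler_sumr; congr (_ - _).
    by apply: eq_bigr => k _; rewrite lfun_powSr.
  by apply: eq_bigr => k _; rewrite scalerA.
rewrite linearB linearZ /=; apply: cvgvB; first exact: entire_lfun_cvg.
exact/cvgv_scale/(cvgvS (@entire_lfun_cvg _ A x gc)).
Qed.

End EntireFunctionalCalculus.
(** * Spectral decomposition of a sigma-operator *)

Section SigmaOperator.
Variables (R : realType) (V : vectType R[i]) (A : 'End(V)).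
Local Notation C := R[i].
Local Notation lambda pq := (lattice_pt R pq.1 pq.2).
Hypothesis sigmaA : entire_lfun (@sigma R) A = 0.
Implicit Types (x y v w : V) (p q r s : int) (pq : int * int).

Lemma sigma_entire : exists c, expansion (@sigma R) c.
Proof.
have [[c Hc] sH _] := sigma_divP R 0 0; exists (mul_linear_coef (lattice_pt R 0 0) c).
by rewrite (_ : sigma (R := R) = fun z => (z - lattice_pt R 0 0) * sigma_div 0 0 z);
  [exact: expansion_mul_linear | exact/funext].
Qed.

Lemma sigma_div_entire p q : exists c, expansion (@sigma_div R p q) c.
Proof. by have [] := sigma_divP R p q. Qed.

Lemma sigma_eq0 (z : C) : (sigma z = 0) <-> exists p q, z = lattice_pt R p q.
Proof.
split=> [z0|[p [q ->]]]; last first.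
  by have [_ -> _] := sigma_divP R p q; rewrite subrr mul0r.
apply: contrapT => nz; have [_ sE s0] := sigma_divP R 0 0.
have : sigma z != 0; last by rewrite z0 eqxx.
rewrite sE mulf_neq0 //; last by apply: s0 => p q zpq; case: nz; exists p, q.
by rewrite subr_eq0; apply/eqP => zl; apply: nz; exists 0, 0.
Qed.

Lemma sigma_div_lattice p q r s : (r, s) != (p, q) ->
  sigma_div p q (lattice_pt R r s) = 0.
Proof.
move=> rspq; have [_ sE _] := sigma_divP R p q.
have /eqP := sE (lattice_pt R r s).
rewrite (proj2 (sigma_eq0 _)); last by exists r, s.
rewrite eq_sym mulf_eq0 subr_eq0 => /orP[/eqP/lattice_pt_inj rs|/eqP//].
by rewrite rs eqxx in rspq.
Qed.

Lemma sigma_div_lattice_neq0 p q : sigma_div p q (lattice_pt R p q) != 0.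
Proof.
by have [_ _] := sigma_divP R p q; apply=> r s /lattice_pt_inj.
Qed.

(** A generalised eigenvector of height 2 with image [w] under [A - a] is sent
    by [sigma A] to a nonzero multiple of [w], because the zeros of [sigma] are
    simple. *)
Lemma generalized_eigen x (a : C) : A (A x - a *: x) = a *: (A x - a *: x) ->
  A x = a *: x /\ (x != 0 -> exists p q, a = lattice_pt R p q).
Proof.
have lattice_eigen y : A y = a *: y -> y != 0 -> exists p q, a = lattice_pt R p q.
  move=> Ay y0; apply/sigma_eq0.
  have := entire_lfun_eigen sigma_entire Ay.
  rewrite sigmaA lfunE /= => /esym/eqP; rewrite scaler_eq0 (negPf y0) orbF.
  by move/eqP.
move=> Aw; have Ax : A x = a *: x; last by split=> //; exact: lattice_eigen.
apply/eqP; rewrite -subr_eq0; apply/negPn/negP => w0.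
have [p [q apq]] := lattice_eigen _ Aw w0.
have [_ sE _] := sigma_divP R p q.
have := entire_lfun_mul_linear A x (sigma_div_entire p q) sE.
rewrite sigmaA lfunE -apq (entire_lfun_eigen (sigma_div_entire p q) Aw) /= => /esym/eqP.
by rewrite scaler_eq0 (negPf w0) orbF apq (negPf (sigma_div_lattice_neq0 _ _)).
Qed.

Definition eigen_decomposition x (l : seq ((int * int) * V)) :=
  (forall y : (int * int) * V, y \in l -> A y.2 = lambda y.1 *: y.2) /\ x = \sum_(y <- l) y.2.

(** If [A x - a *: x] is a sum of eigenvectors, those with eigenvalue different
    from [a] can be divided out by [A - a]; what remains of [x] is a generalised
    eigenvector of height at most 2, hence an eigenvector or zero. *)
Lemma killed_decomposition (rs : seq C) x :
  foldr (fun a y => A y - a *: y) x rs = 0 -> exists l, eigen_decomposition x l.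
Proof.
elim/last_ind: rs x => [|rs a IH] x /=.
  by move=> ->; exists [::]; split=> //; rewrite big_nil.
rewrite foldr_rcons => /IH[l [lE yE]].
pose z := \sum_(y <- l | lambda y.1 != a) (lambda y.1 - a)^-1 *: y.2.
have AzE : A z - a *: z = \sum_(y <- l | lambda y.1 != a) y.2.
  rewrite /z linear_sum scaler_sumr -sumrB big_seq_cond [RHS]big_seq_cond.
  apply: eq_bigr => y /andP[yl ya]; rewrite linearZ /= lE // !scalerA -scalerBl.
  by rewrite [a * _]mulrC -mulrBr mulVf ?scale1r // subr_eq0.
have Ax' : A (x - z) - a *: (x - z) = \sum_(y <- l | ~~ (lambda y.1 != a)) y.2.
  have -> : A (x - z) - a *: (x - z) = (A x - a *: x) - (A z - a *: z).
    by rewrite linearB scalerBr !opprB addrACA [RHS]addrACA [- A z + _]addrC.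
  rewrite AzE yE.
  by rewrite (bigID (fun u : (int * int) * V => lambda u.1 != a)) /= addrAC subrr add0r.
have [|Axz xz0] := @generalized_eigen (x - z) a.
  rewrite Ax' linear_sum scaler_sumr big_seq_cond [RHS]big_seq_cond.
  by apply: eq_bigr => y /andP[yl /negPn/eqP <-] /=; rewrite lE.
pose l' := [seq (u.1, (lambda u.1 - a)^-1 *: u.2) | u <- l & lambda u.1 != a].
have l'E : forall u, u \in l' -> A u.2 = lambda u.1 *: u.2.
  move=> _ /mapP[u + ->] /=; rewrite mem_filter => /andP[_ ul].
  by rewrite linearZ /= lE // !scalerA mulrC.
have zE : z = \sum_(u <- l') u.2 by rewrite big_map big_filter.
have [x_z|/xz0[p [q apq]]] := eqVneq (x - z) 0.
  by exists l'; split=> //; rewrite -zE; apply/eqP; rewrite -subr_eq0 x_z.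
exists (((p, q), x - z) :: l'); split; last by rewrite big_cons -zE subrK.
by move=> u; rewrite inE => /orP[/eqP -> /=|/l'E //]; rewrite -apq.
Qed.

Let papp n (P : {poly C}) x := \sum_(0 <= k < n) P`_k *: lfun_pow A k x.

Let papp_mul_linear n (P : {poly C}) (a : C) x : (size P <= n)%N ->
  papp n.+1 (('X - a%:P) * P) x = A (papp n.+1 P x) - a *: papp n.+1 P x.
Proof.
move=> Pn; rewrite /papp mulrBl.
under eq_bigr do rewrite coefB coefCM scalerBl -scalerA.
rewrite sumrB -scaler_sumr; congr (_ - _).
rewrite big_nat_recl // mulrC coefMX scale0r add0r.
rewrite [in RHS]big_nat_recr //= [in RHS](nth_default _ Pn) scale0r addr0 linear_sum.
by apply: eq_bigr => k _; rewrite coefMX /= comp_lfunE linearZ.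
Qed.

Let papp_prod n (rs : seq C) x : (size rs <= n)%N ->
  papp n.+1 (\prod_(a <- rs) ('X - a%:P)) x = foldr (fun a y => A y - a *: y) x rs.
Proof.
elim: rs => [_|a rs IH rsn].
  rewrite big_nil /papp big_nat_recl // coefC scale1r /= id_lfunE big1 ?addr0 //.
  by move=> k _; rewrite coefC scale0r.
rewrite big_cons papp_mul_linear ?size_prod_XsubC // IH //.
exact: ltnW.
Qed.

(** The first [dim V + 1] iterates of a vector are linearly dependent, which
    gives a polynomial, split over the complex field, that kills the vector. *)
Lemma eigen_decompositionP x : exists l, eigen_decomposition x l.
Proof.
pose n := \dim {:V}; pose X := [tuple lfun_pow A (i : 'I_n.+1) x | i < n.+1].
have nfree : ~ free X.
  rewrite /free size_tuple => /eqP dX.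
  by have := dimvS (subvf <<X>>%VS); rewrite dX ltnn.
have [k [k0 [i ki]]] : exists k : 'I_n.+1 -> C,
    \sum_(i < n.+1) k i *: X`_i = 0 /\ exists i, k i != 0.
  apply: contrapT => no; apply/nfree/freeP => k k0 i; apply/eqP/negPn/negP => ki.
  by apply: no; exists k; split=> //; exists i.
pose P : {poly C} := \poly_(j < n.+1) k (inord j).
have Pi (j : 'I_n.+1) : P`_j = k j by rewrite coef_poly ltn_ord inord_val.
have P0 : P != 0 by apply: contraNneq ki => PE; rewrite -Pi PE coef0.
have PX : papp n.+1 P x = 0.
  rewrite -k0 /papp big_mkord; apply: eq_bigr => j _; rewrite Pi; congr (_ *: _).
  by rewrite -tnth_nth tnth_mktuple.
have [rs PE] := closed_field_poly_normal P.
have rsn : (size rs <= n)%N.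
  rewrite -ltnS -(size_prod_XsubC rs id) -(size_scale _ (_ : lead_coef P != 0)) ?lead_coef_eq0 //.
  by rewrite -PE size_poly.
apply: (@killed_decomposition rs); rewrite -(papp_prod _ rsn).
apply: (scalerI (_ : lead_coef P != 0)); rewrite ?lead_coef_eq0 // scaler0 -PX.
rewrite [in RHS]PE /papp scaler_sumr; apply: eq_bigr => j _.
by rewrite coefZ scalerA.
Qed.

(** * The spectral projections *)

(** The normalised value at [A] of [sigma_div p q] is the projection on the
    eigenspace of [lattice_pt R p q]. It is sealed because unification would
    otherwise unfold and compare infinite products. *)
Fact eigen_proj_spec : {P : int -> int -> 'End(V) | forall p q, P p q =
  (sigma_div p q (lattice_pt R p q))^-1 *: entire_lfun (@sigma_div R p q) A}.
Proof. by eexists => p q. Qed.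

Definition eigen_proj := sval eigen_proj_spec.

Lemma eigen_proj_def p q : eigen_proj p q =
  (sigma_div p q (lattice_pt R p q))^-1 *: entire_lfun (@sigma_div R p q) A.
Proof. exact: svalP eigen_proj_spec p q. Qed.

Lemma eigen_projE p q r s x : A x = lattice_pt R r s *: x ->
  eigen_proj p q x = if (r, s) == (p, q) then x else 0.
Proof.
move=> Ax; rewrite eigen_proj_def scale_lfunE (entire_lfun_eigen (sigma_div_entire p q) Ax) scalerA.
case: eqP => [[-> ->]|/eqP rspq]; last first.
  by rewrite (sigma_div_lattice rspq) mulr0 scale0r.
by rewrite mulVf ?scale1r // sigma_div_lattice_neq0.
Qed.

Lemma eigen_proj_eigen p q x : A (eigen_proj p q x) = lattice_pt R p q *: eigen_proj p q x.
Proof.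
have [l [lE ->]] := eigen_decompositionP x.
rewrite !linear_sum big_seq [RHS]big_seq; apply: eq_bigr => y yl /=.
rewrite (eigen_projE _ _ (lE _ yl)); case: eqP => [[<- <-]|_]; first exact: lE.
by rewrite linear0 scaler0.
Qed.

Lemma eigen_projM p q x : eigen_proj p q (A x) = lattice_pt R p q *: eigen_proj p q x.
Proof.
have [l [lE ->]] := eigen_decompositionP x.
rewrite !linear_sum big_seq [RHS]big_seq; apply: eq_bigr => y yl /=.
rewrite lE // linearZ /= (eigen_projE _ _ (lE _ yl)).
by case: eqP => [[-> ->]|_] //; rewrite !scaler0.
Qed.

Lemma eigen_proj_sum : exists2 S : seq (int * int), uniq S &
  forall x, x = \sum_(pq <- S) eigen_proj pq.1 pq.2 x.
Proof.
have /choice[L LE] : forall i : 'I_(\dim {:V}), exists l, eigen_decomposition (vbasis {:V})`_i l.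
  by move=> i; exact: eigen_decompositionP.
pose S := undup (flatten [seq unzip1 (L i) | i : 'I_(\dim {:V})]).
exists S; first exact: undup_uniq.
move=> x; rewrite (coord_vbasis (memvf x)).
under [RHS]eq_bigr do rewrite linear_sum; rewrite exchange_big /=.
apply: eq_bigr => i _; under eq_bigr do rewrite linearZ; rewrite -scaler_sumr.
congr (_ *: _); have [lE ->] := LE i.
under [RHS]eq_bigr do rewrite linear_sum; rewrite exchange_big /=.
rewrite big_seq [RHS]big_seq; apply: eq_bigr => y yl.
have yS : y.1 \in S.
  rewrite mem_undup; apply/flattenP; exists (unzip1 (L i)); last exact: map_f.
  by apply: map_f; rewrite mem_enum.
rewrite (bigD1_seq y.1 yS (undup_uniq _)) big1 => [|pq pqy].
  by rewrite (eigen_projE _ _ (lE _ yl)) eqxx [RHS]addr0.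
rewrite (eigen_projE _ _ (lE _ yl)) -!surjective_pairing eq_sym.
by rewrite (negPf pqy).
Qed.

Lemma mem_leigenspace p q x :
  (x \in passmx.leigenspace A (lattice_pt R p q)) = (A x == lattice_pt R p q *: x).
Proof. by rewrite memv_ker add_lfunE opp_lfunE scale_lfunE id_lfunE subr_eq0. Qed.

End SigmaOperator.
(** * The weight and Hodge filtrations *)

Lemma conj_defect_scale (R : realType) (V : vectType R) (A S T : 'End(cplx V))
    (c d : R[i]) x : (T \o (lfun_conj A - A) \o S)%VF = 0 ->
  (d *: T) (cplx_conj (A (cplx_conj ((c *: S) x))) - A ((c *: S) x)) = 0.
Proof.
move=> /lfunP/(_ x); rewrite !comp_lfunE zero_lfunE add_lfunE opp_lfunE lfun_conjE.
rewrite !scale_lfunE; move: (S x) => y h.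
rewrite cplx_conjZ [A (_ *: cplx_conj y)]linearZ cplx_conjZ conjcK.
by rewrite [A (_ *: y)]linearZ -scalerBr [T _]linearZ /= h !scaler0.
Qed.

Section Filtrations.
Variables (R : realType) (V : vectType R) (A : 'End(cplx V)).
Hypothesis hA : weakly_pseudo_real A.
Implicit Types (x y : cplx V) (p q r s n : int) (pq : int * int).
Let sigmaA : entire_lfun (@sigma R) A = 0. Proof. by have [] := hA. Qed.
Local Notation lambda p q := (lattice_pt R p q).
Local Notation proj := (eigen_proj A).
Local Notation bar := (@cplx_conj R V).
Local Notation W := (weight_filtration A).
Local Notation F := (hodge_filtration A).

Lemma eigen_IP p q x : reflect (A x = lambda p q *: x) (x \in eigen_I A p q).
Proof. by rewrite /eigen_I mem_leigenspace; exact: eqP. Qed.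

Lemma proj_proj p q r s x :
  proj p q (proj r s x) = if (r, s) == (p, q) then proj r s x else 0.
Proof. exact: (eigen_projE _ _ (eigen_proj_eigen sigmaA r s x)). Qed.

Lemma finite_eigen_I (Q : set (int * int)) :
  finite_set (Q `&` (fun pq => eigen_I A pq.1 pq.2) @^-1` [set~ 0%VS]).
Proof.
have [S _ SE] := eigen_proj_sum sigmaA.
apply: (sub_finite_set (B := [set` S])); last exact: finite_seq.
move=> [p q] /= [_ I0]; apply: contrapT => /negP pqS; apply: I0.
apply/eqP; rewrite -subv0; apply/subvP => v /eigen_IP Av; rewrite memv0.
apply/eqP; rewrite (SE v) big_seq big1 // => rs rsS; rewrite (eigen_projE _ _ Av).
case: eqP => // rsE; move: pqS; rewrite rsE -surjective_pairing.
by rewrite rsS.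
Qed.

(** Membership in a sum of eigenspaces, tested by the spectral projections: this
    is how the weight and Hodge filtrations are handled below. *)
Lemma mem_eigen_sum (Q : set (int * int)) x :
  x \in \big[addv/0%VS]_(pq \in Q) eigen_I A pq.1 pq.2 <->
  forall p q, ~ Q (p, q) -> proj p q x = 0.
Proof.
have inS pq : (pq \in finite_support 0%VS Q (fun pq => eigen_I A pq.1 pq.2)) <->
    Q pq /\ eigen_I A pq.1 pq.2 <> 0%VS.
  have E := in_finite_support (finite_eigen_I Q) pq.
  split=> h; first exact: (set_mem (etrans (esym E) h)).
  exact: (etrans E (mem_set h)).
split=> [xQ p q nQ|x0].
  suff : (\big[addv/0%VS]_(pq \in Q) eigen_I A pq.1 pq.2 <= lker (proj p q))%VS.
    by move=> /subvP /(_ _ xQ); rewrite memv_ker => /eqP.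
  rewrite big_seq; apply: (big_ind (fun U => (U <= lker (proj p q))%VS)) => [|U U' Uk U'k|rs].
  - exact: sub0v.
  - by rewrite subv_add Uk.
  move=> /inS[Qrs _]; apply/subvP => y /eigen_IP Ay.
  rewrite memv_ker (eigen_projE _ _ Ay); case: ifP => // /eqP rsE.
  by case: nQ; rewrite -rsE -surjective_pairing.
have [S _ SE] := eigen_proj_sum sigmaA.
rewrite (SE x); apply: memv_suml => -[p q] _ /=.
have [/= Qpq|/x0 ->] := pselect (Q (p, q)); last exact: mem0v.
have pI : proj p q x \in eigen_I A p q by apply/eigen_IP; exact: eigen_proj_eigen.
have [I0|/eqP I0] := eqVneq (eigen_I A p q) 0%VS.
  by move: pI; rewrite I0 memv0 => /eqP ->; exact: mem0v.
have pqS : (p, q) \in finite_support 0%VS Q (fun pq => eigen_I A pq.1 pq.2).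
  exact/inS.
rewrite (bigD1_seq (p, q) pqS (finite_support_uniq _ _ _)).
by move: pI; apply/subvP; exact: addvSl.
Qed.

Lemma mem_weight n x : x \in W n <-> forall p q, n < p + q -> proj p q x = 0.
Proof.
rewrite mem_eigen_sum; split=> h p q; first by rewrite ltNge => /negP; exact: h.
by move=> /negP; rewrite -ltNge; exact: h.
Qed.

Lemma mem_hodge n x : x \in F n <-> forall p q, p < n -> proj p q x = 0.
Proof.
rewrite mem_eigen_sum; split=> h p q; first by rewrite ltNge => /negP; exact: h.
by move=> /negP; rewrite -ltNge; exact: h.
Qed.

Lemma weight_increasing : increasing_filtration W.
Proof.
move=> m n mn; apply/subvP => x /mem_weight xm; apply/mem_weight => p q npq.
exact/xm/(le_lt_trans mn).
Qed.

Lemma hodge_decreasing : decreasing_filtration F.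
Proof.
move=> m n mn; apply/subvP => x /mem_hodge xn; apply/mem_hodge => p q pm.
exact/xn/(lt_le_trans pm).
Qed.

Lemma int_seq_bounded (S : seq (int * int)) (g : int * int -> int) :
  exists m n, forall pq, pq \in S -> m < g pq < n.
Proof.
elim: S => [|a S [m [n mn]]]; first by exists 0, 0.
exists (Num.min m (g a - 1)), (Num.max n (g a + 1)) => pq.
rewrite inE => /orP[/eqP ->|/mn /andP[mg gn]]; first lia.
lia.
Qed.

Lemma weight_finite : finite_increasing_filtration W.
Proof.
have [S _ SE] := eigen_proj_sum sigmaA.
have [m [n mn]] := int_seq_bounded S (fun pq => pq.1 + pq.2).
split; first exact: weight_increasing.
- exists m; apply/eqP; rewrite -subv0; apply/subvP => x /mem_weight xm.
  rewrite (SE x) big_seq big1 ?mem0v // => pq /mn /andP[mpq _]; exact: xm.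
exists n; apply/vspaceP => x; rewrite memvf; apply/mem_weight => p q npq.
rewrite (SE x) linear_sum big_seq big1 // => rs /mn /andP[_ rsn] /=.
rewrite proj_proj; case: eqP => // -[rsE1 rsE2]; move: rsn npq; rewrite rsE1 rsE2; lia.
Qed.

Lemma hodge_finite : finite_decreasing_filtration F.
Proof.
have [S _ SE] := eigen_proj_sum sigmaA.
have [m [n mn]] := int_seq_bounded S fst.
split; first exact: hodge_decreasing.
- exists m; apply/vspaceP => x; rewrite memvf; apply/mem_hodge => p q pm.
  rewrite (SE x) linear_sum big_seq big1 // => rs /mn /andP[mrs _] /=.
  rewrite proj_proj; case: eqP => // -[rsE1 rsE2]; move: mrs pm; rewrite rsE1; lia.
exists n; apply/eqP; rewrite -subv0; apply/subvP => x /mem_hodge xm.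
rewrite (SE x) big_seq big1 ?mem0v // => pq /mn /andP[_ pqn]; exact: xm.
Qed.

(** * Conjugation *)

(** The weak pseudo-reality condition: conjugating [A] changes it on [I^{p,q}]
    by a map into lower weight. *)
Lemma weak_reality p q r s x : p + q <= r + s ->
  proj r s (bar (A (bar (proj p q x))) - A (proj p q x)) = 0.
Proof.
move=> pqrs; rewrite (eigen_proj_def A p q) (eigen_proj_def A r s).
by apply: conj_defect_scale; have [_] := hA; apply.
Qed.

Lemma barB x y : bar (x - y) = bar x - bar y.
Proof. by rewrite cplx_conjD -scaleN1r cplx_conjZ rmorphN1 scaleN1r. Qed.

Lemma bar_sum (I : Type) (t : seq I) (G : I -> cplx V) :
  bar (\sum_(i <- t) G i) = \sum_(i <- t) bar (G i).
Proof. exact: (big_morph bar (@cplx_conjD R V) (@cplx_conj0 R V)). Qed.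

(** For [x] in [I^{p,q}] the vector [u = A (bar x) - lambda q p * bar x] is the
    conjugate of [(conj A - A) x], hence has weight below [p + q]; its component
    of index [(r, s)] is [lambda r s - lambda q p] times that of [bar x]. *)
Lemma bar_eigen_step p q x :
  (forall y, y \in W (p + q - 1) -> bar y \in W (p + q - 1)) ->
  forall r s, p + q <= r + s -> (r, s) != (q, p) ->
  proj r s (bar (proj p q x)) = 0.
Proof.
move=> WC r s pqrs rsqp; set v := proj p q x.
have Av : A v = lambda p q *: v by exact: eigen_proj_eigen.
pose u := A (bar v) - lambda q p *: bar v.
have uW : u \in W (p + q - 1).
  rewrite -[u]cplx_conjK; apply/WC/mem_weight => p' q' pq'.
  rewrite /u barB cplx_conjZ conjc_lattice_pt cplx_conjK -Av.
  by apply: weak_reality; lia.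
have : proj r s u = 0 by move/mem_weight : uW; apply; lia.
rewrite /u linearB linearZ /= eigen_projM // -scalerBl => /eqP.
rewrite scaler_eq0 subr_eq0 => /orP[/eqP/lattice_pt_inj rsE|/eqP //].
by rewrite rsE eqxx in rsqp.
Qed.

(** Induction on the weight: in weight [n] the conjugate of [I^{p,q}] lies in
    [I^{q,p}] up to lower weight, as soon as [W_{n-1}] is stable. *)
Lemma bar_weight n x : x \in W n -> bar x \in W n.
Proof.
have [_ [m Wm] _] := weight_finite.
have [S _ SE] := eigen_proj_sum sigmaA.
have low n' : n' <= m -> W n' = 0%VS.
  by move=> n'm; apply/eqP; rewrite -subv0 -Wm; exact: weight_increasing.
have [/low -> |mn] := lerP n m.
  by rewrite !memv0 => /eqP ->; rewrite cplx_conj0.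
have [k ->] : exists k : nat, n = m + k%:Z by exists (absz (n - m)); lia.
elim: k {mn} x => [|k IH] x.
  by rewrite addr0 Wm !memv0 => /eqP ->; rewrite cplx_conj0.
move=> /mem_weight xW; rewrite (SE x) bar_sum; apply: memv_suml => -[p q] _ /=.
have [pq_lt|pq_ge] := ltrP (p + q) (m + k.+1%:Z).
  apply: (subvP (weight_increasing (m := m + k%:Z) _)); first by lia.
  apply/IH/mem_weight => r s rs; rewrite proj_proj; case: eqP => // -[pr qs].
  by exfalso; lia.
have [pqE|/eqP pqn] := eqVneq (p + q) (m + k.+1%:Z); last first.
  by rewrite xW ?cplx_conj0 ?mem0v //; lia.
apply/mem_weight => r s rs; apply: bar_eigen_step; try lia.
  move=> y; have -> : p + q - 1 = m + k%:Z by lia.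
  exact: IH.
by apply/eqP => -[rq sp]; lia.
Qed.

Lemma bar_eigen p q r s x : p + q <= r + s -> (r, s) != (q, p) ->
  proj r s (bar (proj p q x)) = 0.
Proof. by apply: bar_eigen_step => y; exact: bar_weight. Qed.

End Filtrations.
(** * Real forms *)

Section RealForm.
Variables (R : realType) (V : vectType R).
Implicit Types (U : {vspace cplx V}) (z : cplx V).

Definition real_form U : {vspace V} :=
  (<<[seq z.1 | z : cplx V <- vbasis U]>> + <<[seq z.2 | z : cplx V <- vbasis U]>>)%VS.

Lemma cplx_coords z :
  z = cplx_inj z.1 + Complex 0 1 *: cplx_inj z.2.
Proof.
case: z => x y; rewrite cplx_scaleE cplx_addE /cplx_scale /cplx_inj /=.
by rewrite !(scale0r, scale1r, scaler0, subr0, addr0, add0r).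
Qed.

(** The real and imaginary parts are half the sum of [z] and its conjugate, and
    their difference divided by twice the imaginary unit. *)
Lemma real_parts_mem U z : (forall x, x \in U -> cplx_conj x \in U) -> z \in U ->
  cplx_inj z.1 \in U /\ cplx_inj z.2 \in U.
Proof.
move=> UC zU; have cU := UC _ zU.
have half (x : V) : (1 / 2 : R) *: (x + x) = x.
  by rewrite scalerDr -scalerDl -splitr scale1r.
have -> : cplx_inj z.1 = Complex (1 / 2) 0 *: (z + cplx_conj z).
  case: z {zU cU} => x y; rewrite cplx_scaleE cplx_addE /cplx_scale /cplx_inj /=.
  rewrite subrr !(scale0r, scaler0, subr0, addr0).
  by rewrite half.
have -> : cplx_inj z.2 = Complex 0 (- (1 / 2)) *: (z - cplx_conj z).
  case: z {zU cU} => x y.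
  have -> : (x, y) - cplx_conj (x, y) = (0, y + y) :> cplx V.
    by apply: injective_projections; rewrite /= ?subrr ?opprK.
  rewrite cplx_scaleE /cplx_scale /cplx_inj /=.
  rewrite !(scale0r, scaler0, add0r, addr0) scaleNr opprK.
  by rewrite half.
by split; apply: memvZ; [exact: memvD | exact: memvB].
Qed.

Lemma vspace_cplx_real_form U : (forall x, x \in U -> cplx_conj x \in U) ->
  vspace_cplx (real_form U) = U.
Proof.
move=> UC; apply/vspaceP => z; rewrite memv_cplx; apply/andP/idP => [[z1 z2]|].
  have inj_mem x : x \in real_form U -> cplx_inj x \in U.
    have injD : {morph @cplx_inj R V : x y / x + y}.
      by move=> u v; rewrite cplx_addE /= addr0.
    have injZ (a : R) (u : V) : cplx_inj (a *: u) = Complex a 0 *: cplx_inj u.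
      by rewrite cplx_scaleE /cplx_scale /cplx_inj /= !scale0r scaler0 subr0 addr0.
    have span_mem (s : seq V) y : (forall u, u \in s -> cplx_inj u \in U) ->
        y \in span s -> cplx_inj y \in U.
      move=> sU /(coord_span (X := in_tuple s)) ->.
      rewrite (big_morph _ injD (erefl _)); apply: memv_suml => i _.
      by rewrite injZ memvZ // sU // mem_nth.
    move=> /memv_addP[x1 x1U [x2 x2U ->]]; rewrite injD memvD //.
      apply: span_mem x1U => _ /mapP[b /vbasis_mem bU ->].
      by have [] := real_parts_mem UC bU.
    apply: span_mem x2U => _ /mapP[b /vbasis_mem bU ->].
    by have [] := real_parts_mem UC bU.
  by rewrite [z]cplx_coords memvD ?memvZ ?inj_mem.
move=> /coord_vbasis ->; apply: (big_ind (fun z : cplx V =>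
  z.1 \in real_form U /\ z.2 \in real_form U)) => [|u v [u1 u2] [v1 v2]|i _].
- by rewrite /= !mem0v.
- by rewrite cplx_addE /= !memvD.
set b : cplx V := (vbasis U)`_i.
have b1 : b.1 \in real_form U.
  apply: (subvP (addvSl _ _)); apply: memv_span; apply: (map_f (fun z : cplx V => z.1)).
  by rewrite mem_nth // size_tuple.
have b2 : b.2 \in real_form U.
  apply: (subvP (addvSr _ _)); apply: memv_span; apply: (map_f (fun z : cplx V => z.2)).
  by rewrite mem_nth // size_tuple.
move: b1 b2; case: (coord _ _ _) => a c; case: b => x y /= xU yU.
by rewrite memvB ?memvD ?memvZ.
Qed.

Lemma vspace_cplx_inj : injective (@vspace_cplx R V).
Proof.
move=> U U' UU'; apply/vspaceP => x.
have := congr1 (fun X : {vspace cplx V} => (x, 0) \in X) UU'.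
by rewrite !memv_cplx /= !mem0v !andbT.
Qed.

Lemma vspace_cplx_sub (U U' : {vspace V}) :
  (vspace_cplx U <= vspace_cplx U')%VS = (U <= U')%VS.
Proof.
apply/subvP/subvP => [UU' x xU|UU' z]; last first.
  by rewrite !memv_cplx => /andP[/UU' -> /UU' ->].
have := UU' (x, 0); rewrite !memv_cplx /= !mem0v !andbT; exact.
Qed.

Lemma vspace_cplx0 : vspace_cplx (0%VS : {vspace V}) = 0%VS.
Proof.
apply/vspaceP => -[x y]; rewrite memv_cplx !memv0.
by rewrite -[RHS]/((x == 0) && (y == 0)).
Qed.

Lemma vspace_cplx_full : vspace_cplx (fullv : {vspace V}) = fullv.
Proof. by apply/vspaceP => z; rewrite memv_cplx !memvf. Qed.

End RealForm.

(** * Complexified quotients *)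

Section ComplexifiedQuotient.
Variables (R : realType) (V : vectType R) (U U' : {vspace V}).
Hypothesis U'U : (U' <= U)%VS.
Local Notation phi := (lfun_cplx (quot_proj U U')).

Lemma quot_cplx_eq0 x : x \in vspace_cplx U -> (phi x == 0) = (x \in vspace_cplx U').
Proof.
rewrite !memv_cplx lfun_cplxE => /andP[x1 x2].
by rewrite -(quot_proj_ker U'U x1) -(quot_proj_ker U'U x2).
Qed.

Lemma quot_cplx_onto : (phi @: vspace_cplx U = fullv)%VS.
Proof.
apply/vspaceP => -[y1 y2]; rewrite memvf; apply/memv_imgP.
have lift (y : quot U U') : exists2 x, x \in U & y = quot_proj U U' x.
  by apply/memv_imgP; rewrite quot_proj_onto memvf.
have [x1 x1U ->] := lift y1; have [x2 x2U ->] := lift y2.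
by exists (x1, x2); rewrite ?memv_cplx ?x1U ?lfun_cplxE.
Qed.

Lemma quot_cplx_conj x : phi (cplx_conj x) = cplx_conj (phi x).
Proof. by rewrite !lfun_cplxE /cplx_conj /= linearN. Qed.

End ComplexifiedQuotient.
(** * The mixed Hodge structure *)

Section MixedHodgeStructure.
Variables (R : realType) (V : vectType R) (A : 'End(cplx V)).
Hypothesis hA : weakly_pseudo_real A.
Let sigmaA : entire_lfun (@sigma R) A = 0. Proof. by have [] := hA. Qed.
Local Notation proj := (eigen_proj A).
Local Notation bar := (@cplx_conj R V).
Local Notation W := (weight_filtration A).
Local Notation F := (hodge_filtration A).
Local Notation WR n := (real_form (weight_filtration A n)).

Lemma weight_real n : vspace_cplx (WR n) = W n.
Proof. by apply: vspace_cplx_real_form => x; exact: bar_weight. Qed.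

Lemma real_weight_finite : finite_increasing_filtration (fun n => WR n).
Proof.
have [Winc [m Wm] [n Wn]] := weight_finite hA; split.
- by move=> k l kl; rewrite -vspace_cplx_sub !weight_real Winc.
- by exists m; apply: vspace_cplx_inj; rewrite weight_real Wm vspace_cplx0.
- by exists n; apply: vspace_cplx_inj; rewrite weight_real Wn vspace_cplx_full.
Qed.

Section GradedPiece.
Variable n : int.
Local Notation phi := (lfun_cplx (quot_proj (WR n) (WR (n - 1)))).
Local Notation grF := (fun p => phi @: (F p :&: vspace_cplx (WR n)))%VS.

Let W_pred : (WR (n - 1) <= WR n)%VS.
Proof. by have [Winc _ _] := real_weight_finite; apply: Winc; lia. Qed.

Let phi_eq0 x : x \in W n -> (phi x == 0) = (x \in W (n - 1)).
Proof. by move=> xW; rewrite quot_cplx_eq0 ?weight_real. Qed.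

Let mem_grF p x : x \in F p -> x \in W n -> phi x \in grF p.
Proof. by move=> xF xW; apply: memv_img; rewrite memv_cap xF weight_real. Qed.

Let grFP p y : y \in grF p -> exists x, [/\ x \in F p, x \in W n & y = phi x].
Proof.
by move=> /memv_imgP[x + ->]; rewrite memv_cap weight_real => /andP[]; exists x.
Qed.

Let projW p q x : x \in W n -> proj p q x \in W n.
Proof.
move=> /(mem_weight hA) xW; apply/(mem_weight hA) => r s nrs.
by rewrite proj_proj //; case: eqP => [[-> ->]|//]; exact: xW.
Qed.

Let proj_hodge p q x m : m <= p -> proj p q x \in F m.
Proof.
move=> mp; apply/(mem_hodge hA) => r s rm.
by rewrite proj_proj //; case: eqP => // -[pr _]; exfalso; lia.
Qed.

Let gr_hodge_finite : finite_decreasing_filtration grF.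
Proof.
have [Fdec [m Fm] [k Fk]] := hodge_finite hA; split.
- by move=> p q pq; apply: limgS; apply: capvS => //; exact: Fdec.
- by exists m; rewrite Fm capfv quot_cplx_onto.
- by exists k; rewrite Fk cap0v limg0.
Qed.

(** A component [proj k l x] with [k + l = n] either has [k >= p] or is, up to
    lower weight, the conjugate of an element of [I^{l,k}] with
    [l >= n + 1 - p]. *)
Let gr_hodge_add p : (grF p + vspace_conj (grF (n + 1 - p)) = fullv)%VS.
Proof.
apply/vspaceP => y; rewrite memvf.
have /memv_imgP[x xW ->] : y \in (phi @: vspace_cplx (WR n))%VS.
  by rewrite quot_cplx_onto memvf.
rewrite weight_real in xW.
have [S _ SE] := eigen_proj_sum sigmaA.
rewrite (SE x) linear_sum; apply: memv_suml => -[k l] _ /=.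
set v := proj k l x; have vW : v \in W n by exact: projW.
have [kl_lt|kl_gt|kl] := ltgtP (k + l) n.
- have -> : phi v = 0.
    apply/eqP; rewrite phi_eq0 //; apply/(mem_weight hA) => r s rs.
    by rewrite proj_proj //; case: eqP => // -[kr ls]; exfalso; lia.
  exact: mem0v.
- have -> : v = 0 by move/(mem_weight hA) : xW; apply.
  by rewrite linear0 mem0v.
have [pk|kp] := lerP p k.
  by apply: (subvP (addvSl _ _)); apply: mem_grF => //; exact: proj_hodge.
apply: (subvP (addvSr _ _)); rewrite memv_conj -quot_cplx_conj.
have bvW : bar v \in W n by exact: bar_weight.
have -> : phi (bar v) = phi (proj l k (bar v)).
  apply/eqP; rewrite -subr_eq0 -linearB phi_eq0; last by rewrite memvB ?projW.
  apply/(mem_weight hA) => r s rs; rewrite linearB /= proj_proj //.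
  case: eqP => [[-> ->]|/eqP lkrs]; first by rewrite subrr.
  by rewrite bar_eigen ?subrr // 1?eq_sym //; lia.
by apply: mem_grF; [apply: proj_hodge; lia | exact: projW].
Qed.

(** If [phi x = bar (phi x')], then [x] and [bar x'] have the same components of
    weight [n]; those of [x] have first index at least [p], those of [bar x']
    have second index at least [n + 1 - p]. *)
Let gr_hodge_cap p : (grF p :&: vspace_conj (grF (n + 1 - p)) = 0)%VS.
Proof.
apply/eqP; rewrite -subv0; apply/subvP => y; rewrite memv_cap memv_conj memv0.
move=> /andP[/grFP[x [xF xW yx]] /grFP[x' [xF' xW' yx']]].
have [S _ SE] := eigen_proj_sum sigmaA.
have xx' : bar x' - x \in W (n - 1).
  have bxW : bar x' \in W n by exact: bar_weight.
  rewrite -phi_eq0 ?memvB // linearB /= quot_cplx_conj -yx' cplx_conjK yx.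
  by rewrite subrr.
rewrite yx phi_eq0 //; apply/(mem_weight hA) => r s rs.
have [nrs|rsn] := ltrP n (r + s); first by move/(mem_weight hA) : xW; apply.
have [rp|pr] := ltrP r p; first by move/(mem_hodge hA) : xF; apply.
have := (mem_weight hA _ _).1 xx' r s rs.
rewrite linearB => /eqP; rewrite subr_eq0 => /eqP <-.
rewrite [x']SE bar_sum linear_sum; apply: big1 => -[k l] _ /=.
have [kln|nkl] := lerP (k + l) n; last first.
  have -> : proj k l x' = 0 by move/(mem_weight hA) : xW'; apply.
  by rewrite cplx_conj0 linear0.
have [rsE|rsl] := eqVneq (r, s) (l, k); last by rewrite bar_eigen //; lia.
case: rsE => rl sk.
have -> : proj k l x' = 0 by move/(mem_hodge hA) : xF'; apply; lia.
by rewrite cplx_conj0 linear0.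
Qed.

Lemma graded_pure_hodge : pure_hodge_structure n grF.
Proof. by split=> [|p]; [exact: gr_hodge_finite | split]. Qed.

End GradedPiece.

End MixedHodgeStructure.

Theorem theorem1p4 (R : realType) (V : vectType R) (A : 'End(cplx V))
    (hA : weakly_pseudo_real A) :
  exists W : int -> {vspace V},
    unique (fun W' : int -> {vspace V} =>
      increasing_filtration W' /\
      forall n : int, vspace_cplx (W' n) = weight_filtration A n) W
    /\ real_mixed_hodge_structure W (hodge_filtration A).
Proof.
exists (fun n => real_form (weight_filtration A n)); split.
  split=> [|W' [_ W'E]].
    by split=> [|n]; [have [] := real_weight_finite hA | exact: weight_real].
  apply/funext => n; apply: vspace_cplx_inj.
  by rewrite weight_real // W'E.
split; first exact: real_weight_finite.
  exact: hodge_finite.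
by move=> n; exact: graded_pure_hodge.
Qed.
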